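(* Let $f\in K(\mathbb{Z})$ and let $\rho$ be a $T$-invariant Borel probability measure of $(X_f,T)$. Then $\rho$ has discrete spectrum.
   Context: For $f\in\ell^\infty(\mathbb{Z})$, let $B_f$ be the smallest translation invariant $*$-subalgebra of $\ell^\infty(\mathbb{Z})$ containing $f$ and the constants; its maximal ideal space $X_f=X(f)$ is compact and metrizable, and may be identified with the set of all pointwise limits of sequences of translates of $f$ (a bounded weak$^*$ closed subset of $\ell^\infty(\mathbb{Z})$, with the topology of pointwise convergence). Translation by one determines a homeomorphism $T$ of $X_f$. $K(\mathbb{Z})$ (introduced by Veech) is the set of $f\in\ell^\infty(\mathbb{Z})$ such that $X_f$, viewed as this subset of $\ell^\infty(\mathbb{Z})$, is separable in the norm topology of $\ell^\infty(\mathbb{Z})$. For a $T$-invariant Borel probability measure $\rho$ on a compact metrizable space $X$, an eigenfunction is a nonzero $g\in L^2(X,\mathcal{B}_X,\rho)$ with $g\circ T=\lambda g$ for some $\lambda\in\mathbb{C}$; $\rho$ has discrete spectrum if the closed linear span of the eigenfunctions is all of $L^2(X,\mathcal{B}_X,\rho)$. *)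

(* Defs.v *)
From HB Require Import structures.
From mathcomp Require Import all_boot all_order all_algebra.
From mathcomp Require Import complex.
From mathcomp Require Import all_classical all_reals all_analysis.
Set Implicit Arguments.
Unset Strict Implicit.
Unset Printing Implicit Defensive.
Import Order.TTheory GRing.Theory Num.Theory.
Import numFieldNormedType.Exports.

Local Open Scope classical_set_scope.
Local Open Scope complex_scope.
Local Open Scope ring_scope.

(* The norm topology is declared on [K^o] for [K : numFieldType]; the concrete
   type [R[i]] does not inherit it automatically. *)
HB.instance Definition _ (R : realType) :=
  PseudoPointedMetric.copy R[i] (R[i])^o.

(* [`|z|] is valued in [R[i]]; [cmod z] is the same modulus, valued in [R]. *)
Definition cmod (R : realType) (z : R[i]) : R := Normc.normc z.

Section Sequences.
Variable R : realType.
Implicit Types f x : int -> R[i].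

Definition linf : set (int -> R[i]) :=
  [set f | has_ubound (range (fun n => cmod (f n)))].

(* [sup] is a junk value on unbounded sets; this is the norm only on [linf]. *)
Definition linf_norm f : R := sup (range (fun n => cmod (f n))).

Definition translate (m : int) f : int -> R[i] := fun n => f (n + m).

(* The elements are the pointwise limits of sequences of translates of [f]; the
   ambient type makes the set carry the topology of pointwise convergence. *)
Definition translate_limits f : set {ptws int -> R[i]} :=
  [set x | exists s : nat -> int,
     forall n : int, (fun k => translate (s k) f n) @ \oo --> x n].

Lemma translate_limits_self f : translate_limits f f.
Proof.
exists (fun=> 0) => n; apply: cvg_near_cst.
by apply: nearW => k; rewrite /translate addr0.
Qed.

Lemma translate_limits_shift f x :
  translate_limits f x -> translate_limits f (translate 1 x).
Proof.
move=> [s sx]; exists (fun k => s k + 1) => n.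
rewrite (_ : (fun k => _) = (fun k => translate (s k) f (n + 1))).
  exact: sx (n + 1).
by apply/funext => k; rewrite /translate [s k + 1]addrC addrA.
Qed.

Definition Xspace f : Type := set_type (translate_limits f).

HB.instance Definition _ f :=
  Topological.copy (Xspace f) (set_type (translate_limits f)).

(* The pointed structure is only there because [measurableType] requires it. *)
HB.instance Definition _ f := isPointed.Build (Xspace f)
  (SigSub (mem_set (translate_limits_self f))).

Definition Xshift f (x : Xspace f) : Xspace f :=
  SigSub (mem_set (translate_limits_shift (set_valP x))).

Definition linf_separable (X : set (int -> R[i])) : Prop :=
  exists D : set (int -> R[i]), [/\ countable D, D `<=` X &
    forall x, X x -> forall e : R, 0 < e ->
      exists2 d, D d & linf_norm (fun n => x n - d n) < e].

Definition KZ : set (int -> R[i]) :=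
  [set f | linf f /\ linf_separable (translate_limits f)].

End Sequences.

Definition borel (X : ptopologicalType) := g_sigma_algebraType (@open X).

Section DiscreteSpectrum.
Context d (X : measurableType d) (R : realType).
Variables (rho : probability X R) (T : X -> X).
Implicit Types g h : X -> R[i].

Definition invariant_measure : Prop :=
  forall A : set X, measurable A -> rho (T @^-1` A) = rho A.

Definition L2norm g : \bar R := Lnorm rho 2%:E (fun x => (cmod (g x))%:E).

Definition L2 : set (X -> R[i]) :=
  [set g | [/\ measurable_fun setT (fun x => complex.Re (g x)),
               measurable_fun setT (fun x => complex.Im (g x)) &
               (L2norm g < +oo)%E]].

(* Elements of L2 are functions, not classes: identities hold rho-a.e. *)
Definition eigenfunction : set (X -> R[i]) :=
  [set g | [/\ L2 g, ~ (g = (fun=> 0) %[ae rho]) &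
     exists lambda : R[i], (g \o T = (fun x => lambda * g x) %[ae rho]) ]].

Definition linear_span (E : set (X -> R[i])) : set (X -> R[i]) :=
  [set h | exists (n : nat) (c : 'I_n -> R[i]) (g : 'I_n -> X -> R[i]),
     (forall i, E (g i)) /\ h = (fun x => \sum_(i < n) c i * g i x)].

Definition L2closure (E : set (X -> R[i])) : set (X -> R[i]) :=
  [set h | L2 h /\ forall e : R, 0 < e ->
     exists2 k, E k & (L2norm (fun x => (h x - k x)%R) < e%:E)%E].

Definition discrete_spectrum : Prop :=
  L2closure (linear_span eigenfunction) = L2.

End DiscreteSpectrum.

(* Main.v *)
Require Import Defs.
From HB Require Import structures.
From mathcomp Require Import all_boot all_order all_algebra.
From mathcomp Require Import complex finmap.
From mathcomp Require Import all_classical all_reals all_analysis.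
From mathcomp Require Import measurable_realfun ring lra.
Set Implicit Arguments.
Unset Strict Implicit.
Unset Printing Implicit Defensive.
Import Order.TTheory GRing.Theory Num.Theory.
Import numFieldNormedType.Exports.
Local Open Scope classical_set_scope.
Local Open Scope complex_scope.
Local Open Scope ring_scope.

(** The shift is an isometry of X_f for the sup norm, and membership in K(Z) says
that X_f is separable for that norm.  The proof turns this into total
boundedness of orbits in L2, and total boundedness into discrete spectrum.

From separability to precompact orbits.  Closed sup-norm balls are closed for
pointwise convergence, hence Borel, so by separability finitely many balls of
small radius cover X_f up to small rho-measure.  On such a cover the function
[y |-> dist (T^n y) x0] is known, up to a small error and whatever n is, once
its values at the finitely many centres are known.  Hence the sets T^-n B, for
B a ball, fall into finitely many classes of rho-close sets (precompact_ball).
The sets with this property form a sigma-algebra (precompact_sigma_algebra),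
and by separability every set that is open for pointwise convergence is a
countable union of balls (open_bigcup_seqball); so every Borel set has it
(borel_precompact).  It follows that simple functions, which are dense in L2,
have totally bounded orbits under the Koopman operator U.

From precompact orbits to eigenvectors (precompact_orbit_span).  Let v have a
totally bounded orbit under the isometry U.  For |z| = 1 the means of the
vectors z^n U^n v converge, by the mean ergodic theorem, to the orthogonal
projection E z v of v on the eigenvectors fixed by z U.  By Bessel only
finitely many z satisfy |E z v| >= d; let w be v minus the corresponding
E z v.  All the limits of means of w are then at most d, and by compactness of
the circle a single length N makes all the means of w of order d
(uniform_mean).  Expanding the fourth power of the norm of
[\sum_(n < N) z^n U^n w] and averaging over the roots of unity of order 2N gives
a finite form of Wiener's lemma: the sum of |<U^m w, U^k w>|^2 over quadruples
with m + m' = k + k' is at most of order N^3 d^2 |w|^2 (fourth_moment_le).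
On the other hand, if times are coloured according to which of L small balls
contains U^n v, then |<U^m w, U^k w>| is close to |w|^2 when m and k share a
colour (remainder_corr), and by the pigeonhole principle this makes the same
sum at least of order N^3 |w|^4 / L (fourth_moment_ge, pigeonhole_corr).  Since
L does not depend on d, letting d be small makes w small: v is a limit of sums
of eigenvectors. *)

(** * Isometries of a complex inner product space and the mean ergodic theorem *)

Definition unimodular (R : realType) (z : R[i]) : Prop :=
  complex.Re z ^+ 2 + complex.Im z ^+ 2 = 1.

Section InnerProduct.
Context {R : realType} {V : lmodType R[i]}.

(** A positive semidefinite Hermitian form is recorded by its real part, for which
multiplication by i is an isometry; the form itself is [hdot] below.  Nonzero
null vectors are allowed, so that functions need not be identified when they
agree almost everywhere: equality of vectors is expressed by [nrm (u - v) = 0]. *)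
Record inner_product (dot : V -> V -> R) : Prop := InnerProduct {
  dotC : forall u v, dot u v = dot v u;
  dotDl : forall u v w, dot (u + v) w = dot u w + dot v w;
  dotZrl : forall (a : R) u v, dot (a%:C *: u) v = a * dot u v;
  dot_ii : forall u v, dot ('i *: u) ('i *: v) = dot u v;
  dot_ge0 : forall u, 0 <= dot u u }.

Variable dot : V -> V -> R.
Hypothesis dotP : inner_product dot.

Definition nrm u := Num.sqrt (dot u u).

Let dC := dotC dotP.
Let dDl := dotDl dotP.
Let dZ := dotZrl dotP.

Lemma dotDr u v w : dot u (v + w) = dot u v + dot u w.
Proof. by rewrite dC dDl ![dot _ u]dC. Qed.

Lemma dot0l u : dot 0 u = 0.
Proof. by have := dZ 0 0 u; rewrite scaler0 mul0r. Qed.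

Lemma dotNl u v : dot (- u) v = - dot u v.
Proof. by apply/eqP; rewrite -addr_eq0 -dDl addNr dot0l. Qed.

Lemma dotNr u v : dot u (- v) = - dot u v.
Proof. by rewrite dC dotNl dC. Qed.

Lemma dotBl u v w : dot (u - v) w = dot u w - dot v w.
Proof. by rewrite dDl dotNl. Qed.

Lemma dotBr u v w : dot w (u - v) = dot w u - dot w v.
Proof. by rewrite dotDr dotNr. Qed.

Lemma dotZrr (a : R) u v : dot u (a%:C *: v) = a * dot u v.
Proof. by rewrite dC dZ dC. Qed.

Lemma dot_suml (I : Type) (s : seq I) (P : pred I) (F : I -> V) v :
  dot (\sum_(i <- s | P i) F i) v = \sum_(i <- s | P i) dot (F i) v.
Proof.
by elim/big_rec2: _ => [|i a b _ <-]; rewrite ?dot0l ?dDl.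
Qed.

Lemma dot_sumr (I : Type) (s : seq I) (P : pred I) (F : I -> V) v :
  dot v (\sum_(i <- s | P i) F i) = \sum_(i <- s | P i) dot v (F i).
Proof. by rewrite dC dot_suml; apply: eq_bigr => i _; rewrite dC. Qed.

Lemma ii_scale (u : V) : 'i *: ('i *: u) = - u.
Proof. by rewrite scalerA -expr2 sqr_i scaleN1r. Qed.

Lemma dot_il u v : dot ('i *: u) v = - dot u ('i *: v).
Proof. by rewrite -(dot_ii dotP ('i *: u)) ii_scale dotNl. Qed.

Lemma scaleReIm (z : R[i]) (u : V) :
  z *: u = (complex.Re z)%:C *: u + (complex.Im z)%:C *: ('i *: u).
Proof. by rewrite {1}[z]complexE scalerDl scalerA mulrC. Qed.

Lemma dotZr z u v :
  dot u (z *: v) = complex.Re z * dot u v + complex.Im z * dot u ('i *: v).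
Proof. by rewrite scaleReIm dotDr !dotZrr. Qed.

Lemma dotZl z u v :
  dot (z *: u) v = complex.Re z * dot u v - complex.Im z * dot u ('i *: v).
Proof. by rewrite dC dotZr dC [dot v ('i *: u)]dC dot_il mulrN. Qed.

Lemma dotZZ z u v :
  dot (z *: u) (z *: v) = (complex.Re z ^+ 2 + complex.Im z ^+ 2) * dot u v.
Proof.
rewrite dotZl (dotZr z u v) scalerA (mulrC _ z) -scalerA (dotZr z u) ii_scale dotNr.
ring.
Qed.

Lemma dotZZ1 z u v : unimodular z -> dot (z *: u) (z *: v) = dot u v.
Proof. by move=> z1; rewrite dotZZ z1 mul1r. Qed.

Lemma cauchy_schwarz_sqr u v : dot u v ^+ 2 <= dot u u * dot v v.
Proof.
have Q a b : 0 <= a ^+ 2 * dot u u - 2 * a * b * dot u v + b ^+ 2 * dot v v.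
  have := dot_ge0 dotP (a%:C *: u - b%:C *: v).
  rewrite dotBl !dotBr !dZ !dotZrr [dot v u]dC; congr (0 <= _); ring.
have [vv|vv] := leP (dot v v) 0.
  have v0 : dot v v = 0 by apply/le_anti; rewrite vv (dot_ge0 dotP).
  (* For a null v, Q is affine in b, hence negative for large b unless dot u v = 0. *)
  have := Q (dot u v) (dot u u + 1); rewrite v0 !mulr0 addr0 => H.
  have : dot u v ^+ 2 * (dot u u + 2) <= 0.
    rewrite -oppr_ge0; move: H; congr (0 <= _); ring.
  by have := dot_ge0 dotP u => u0; rewrite pmulr_lle0 //; lra.
have := Q (dot v v) (dot u v).
by rewrite (_ : _ + _ = dot v v * (dot u u * dot v v - dot u v ^+ 2));
  [rewrite pmulr_rge0 // subr_ge0 | ring].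
Qed.

Lemma nrm_ge0 u : 0 <= nrm u. Proof. exact: sqrtr_ge0. Qed.

Lemma nrm_sqr u : nrm u ^+ 2 = dot u u.
Proof. by rewrite sqr_sqrtr // (dot_ge0 dotP). Qed.

Lemma cauchy_schwarz u v : `|dot u v| <= nrm u * nrm v.
Proof.
rewrite -(ler_pXn2r (ltn0Sn 1)) ?nnegrE ?mulr_ge0 ?nrm_ge0 //.
by rewrite exprMn !nrm_sqr real_normK ?num_real // cauchy_schwarz_sqr.
Qed.

Lemma nrmD u v : nrm (u + v) <= nrm u + nrm v.
Proof.
rewrite -(ler_pXn2r (ltn0Sn 1)) ?nnegrE ?addr_ge0 ?nrm_ge0 //.
rewrite sqrrD !nrm_sqr dDl !dotDr [dot v u]dC.
have := cauchy_schwarz u v; have := ler_norm (dot u v); lra.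
Qed.

Lemma nrm0 : nrm 0 = 0. Proof. by rewrite /nrm dot0l sqrtr0. Qed.

Lemma nrmN u : nrm (- u) = nrm u.
Proof. by rewrite /nrm dotNl dotNr opprK. Qed.

Lemma nrmBC u v : nrm (u - v) = nrm (v - u).
Proof. by rewrite -nrmN opprB. Qed.

Lemma nrmB_tri w u v : nrm (u - v) <= nrm (u - w) + nrm (w - v).
Proof. by have := nrmD (u - w) (w - v); rewrite addrA subrK. Qed.

Lemma nrm_le_add u v : nrm u <= nrm (u - v) + nrm v.
Proof. by have := nrmD (u - v) v; rewrite subrK. Qed.

Lemma nrm_sum (I : Type) (s : seq I) (P : pred I) (F : I -> V) :
  nrm (\sum_(i <- s | P i) F i) <= \sum_(i <- s | P i) nrm (F i).
Proof.
apply: (big_ind2 (fun a b => nrm a <= b)) => [|a x b y ax by_|//].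
  by rewrite nrm0.
exact: le_trans (nrmD _ _) (lerD ax by_).
Qed.

Lemma nrmZr (a : R) u : 0 <= a -> nrm (a%:C *: u) = a * nrm u.
Proof.
by move=> a0; rewrite /nrm dZ dotZrr mulrA -expr2 sqrtrM ?sqr_ge0 // sqrtr_sqr ger0_norm.
Qed.

Lemma nrm0_dotl u v : nrm u = 0 -> dot u v = 0.
Proof.
move=> u0; apply/eqP; rewrite -normr_le0.
by apply: le_trans (cauchy_schwarz _ _) _; rewrite u0 mul0r.
Qed.

Lemma nrm0_dotr u v : nrm v = 0 -> dot u v = 0.
Proof. by rewrite dC; exact: nrm0_dotl. Qed.

Lemma nrm_parallelogram u v :
  nrm (u - v) ^+ 2 = 2 * nrm u ^+ 2 + 2 * nrm v ^+ 2 - nrm (u + v) ^+ 2.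
Proof.
by rewrite !nrm_sqr dotBl !dotBr dDl !dotDr; ring.
Qed.

Definition isometry (W : V -> V) : Prop :=
  [/\ forall u v, W (u + v) = W u + W v,
      forall (z : R[i]) u, W (z *: u) = z *: W u
    & forall u v, dot (W u) (W v) = dot u v].

Lemma isometry_rot z W : unimodular z -> isometry W ->
  isometry (fun u => z *: W u).
Proof.
move=> z1 [WD WZ Wd]; split => [u v|a u|u v].
- by rewrite WD scalerDr.
- by rewrite WZ !scalerA mulrC.
- by rewrite dotZZ1.
Qed.

Lemma isometry_iter n W : isometry W -> isometry (iter n W).
Proof.
move=> [WD WZ Wd]; elim: n => [|n [D Z d]] //; split => [u v|z u|u v] /=.
- by rewrite D WD.
- by rewrite Z WZ.
- by rewrite Wd d.
Qed.

Section Isometries.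
Variable W : V -> V.
Hypothesis isoW : isometry W.

Lemma isoD u v : W (u + v) = W u + W v. Proof. by case: isoW. Qed.
Lemma isoZ z u : W (z *: u) = z *: W u. Proof. by case: isoW. Qed.
Lemma iso_dot u v : dot (W u) (W v) = dot u v. Proof. by case: isoW. Qed.
Lemma iso0 : W 0 = 0. Proof. by rewrite -[in LHS](scale0r 0) isoZ scale0r. Qed.
Lemma isoN u : W (- u) = - W u.
Proof. by rewrite -scaleN1r isoZ scaleN1r. Qed.
Lemma isoB u v : W (u - v) = W u - W v. Proof. by rewrite isoD isoN. Qed.
Lemma iso_nrm u : nrm (W u) = nrm u. Proof. by rewrite /nrm iso_dot. Qed.
Lemma iso_sum (I : Type) (s : seq I) (P : pred I) (F : I -> V) :
  W (\sum_(i <- s | P i) F i) = \sum_(i <- s | P i) W (F i).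
Proof. by elim/big_rec2: _ => [|i a b _ <-]; rewrite ?iso0 ?isoD. Qed.

End Isometries.

Definition mean (W : V -> V) (N : nat) v : V :=
  (N%:R^-1)%:C *: \sum_(0 <= n < N) iter n W v.

Definition mean_limit (W : V -> V) v e : Prop :=
  forall eps : R, 0 < eps -> exists n0 : nat, forall N, (n0 <= N)%N ->
    nrm (mean W N v - e) < eps.

Section MeanErgodic.
Variable W : V -> V.
Hypothesis isoW : isometry W.

Lemma iter_isoD n u v : iter n W (u + v) = iter n W u + iter n W v.
Proof. exact: (isoD (isometry_iter n isoW)). Qed.

Lemma iter_iso_nrm n u : nrm (iter n W u) = nrm u.
Proof. exact: (iso_nrm (isometry_iter n isoW)). Qed.

Lemma meanD N u v : mean W N (u + v) = mean W N u + mean W N v.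
Proof.
rewrite /mean -scalerDr -big_split /=; congr (_ *: _).
by apply: eq_bigr => n _; rewrite iter_isoD.
Qed.

Lemma meanZ N z u : mean W N (z *: u) = z *: mean W N u.
Proof.
rewrite /mean scalerA mulrC -scalerA; congr (_ *: _); rewrite scaler_sumr.
by apply: eq_bigr => n _; rewrite (isoZ (isometry_iter n isoW)).
Qed.

Lemma mean_sum N (I : Type) (s : seq I) (P : pred I) (F : I -> V) :
  mean W N (\sum_(i <- s | P i) F i) = \sum_(i <- s | P i) mean W N (F i).
Proof.
elim/big_rec2: _ => [|i a b _ <-]; last by rewrite meanD.
by rewrite -[in LHS](scale0r 0) meanZ scale0r.
Qed.

Lemma nrm_mean N v : nrm (mean W N v) <= nrm v.
Proof.
rewrite /mean nrmZr ?invr_ge0 ?ler0n //.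
have [->|N0] := posnP N; first by rewrite invr0 mul0r nrm_ge0.
rewrite mulrC ler_pdivrMr ?ltr0n //.
apply: le_trans (nrm_sum _ _ _) _.
under eq_bigr do rewrite iter_iso_nrm.
by rewrite sumr_const_nat subn0 mulr_natr.
Qed.

Lemma iter_comm n v : iter n W (W v) = W (iter n W v).
Proof. by rewrite -iterSr. Qed.

Lemma mean_comm N v : mean W N (W v) = W (mean W N v).
Proof.
rewrite /mean (isoZ isoW) (iso_sum isoW); congr (_ *: _).
by apply: eq_bigr => n _; rewrite iter_comm.
Qed.

Lemma mean_shift N v : nrm (mean W N (W v) - mean W N v) <= 2 * nrm v / N%:R.
Proof.
rewrite /mean -scalerBr nrmZr ?invr_ge0 ?ler0n // mulrC.
apply: ler_wpM2r; first by rewrite invr_ge0 ler0n.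
rewrite -sumrB.
under eq_bigr do rewrite iter_comm.
rewrite (telescope_sumr (fun n => iter n W v)) //=.
apply: le_trans (nrmD _ _) _; rewrite nrmN iter_iso_nrm; lra.
Qed.

Lemma mean_shiftn i N v :
  nrm (mean W N (iter i W v) - mean W N v) <= i%:R * (2 * nrm v / N%:R).
Proof.
elim: i => [|i IH]; first by rewrite subrr nrm0 mul0r.
apply: le_trans (nrmB_tri (mean W N (iter i W v)) _ _) _.
rewrite -natr1 mulrDl mul1r addrC; apply: lerD => //=.
by apply: le_trans (mean_shift _ _) _; rewrite iter_iso_nrm.
Qed.

(** Averaging over P steps hardly sees a preliminary average over N steps, once P is
large compared with N. *)
Lemma mean_mean N P v : (0 < N)%N ->
  nrm (mean W P (mean W N v) - mean W P v) <= N%:R * (2 * nrm v / P%:R).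
Proof.
move=> N0.
have -> : mean W P (mean W N v) - mean W P v =
    (N%:R^-1)%:C *: \sum_(0 <= i < N) (mean W P (iter i W v) - mean W P v).
  rewrite {2}/mean meanZ mean_sum sumrB scalerBr; congr (_ - _).
  rewrite sumr_const_nat subn0 -(scaler_nat _ (mean W P v)) scalerA.
  have -> : (N%:R : R[i]) = (N%:R : R)%:C by rewrite rmorph_nat.
  by rewrite -rmorphM /= mulVf ?scale1r // pnatr_eq0 -lt0n.
rewrite nrmZr ?invr_ge0 ?ler0n // mulrC ler_pdivrMr ?ltr0n //.
apply: le_trans (nrm_sum _ _ _) _.
rewrite mulr_natr -[X in _ *+ X](subn0 N) -sumr_const_nat.
apply: ler_sum_nat => i /andP[_ iN].
apply: le_trans (mean_shiftn _ _ _) _.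
by apply: ler_wpM2r; rewrite ?ler_nat ?(ltnW iN) // !mulr_ge0 ?invr_ge0 ?ler0n ?nrm_ge0.
Qed.

(** The mean ergodic theorem, from the parallelogram law.  Let m be the infimum of
the norms of the means.  By [mean_mean] all long means have norm close to m,
while the sum of two means has norm at least 2 m, because averaging it further
brings it close to twice a mean. *)
Lemma mean_cauchy v (e : R) : 0 < e ->
  exists n0 : nat, forall N M, (n0 <= N)%N -> (n0 <= M)%N ->
    nrm (mean W N v - mean W M v) < e.
Proof.
move=> e0.
pose E := [set nrm (mean W n.+1 v) | n in [set: nat]].
have infE : has_inf E.
  by split; [exists (nrm (mean W 1 v)); exists 0%N | exists 0 => _ [n _ <-]; exact: nrm_ge0].
pose m := inf E.
have m_le n : (0 < n)%N -> m <= nrm (mean W n v).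
  by case: n => // n _; apply: (ge_inf infE.2); exists n.
have m0 : 0 <= m by apply: lb_le_inf; [exact: infE.1 | move=> _ [n _ <-]; exact: nrm_ge0].
have small c (d : R) : 0 < d -> exists n0 : nat, forall P, (n0 <= P)%N ->
    (0 < P)%N -> c * (2 * nrm v / P%:R) < d.
  move=> d0.
  pose n0 := (Num.bound (`|c| * 2 * nrm v / d)).
  exists n0 => P n0P P0.
  rewrite mulrA ltr_pdivrMr ?ltr0n //.
  have h0 : 0 <= `|c| * 2 * nrm v / d.
    by apply: divr_ge0; [rewrite !mulr_ge0 ?nrm_ge0 | exact: ltW].
  have := Num.Theory.archi_boundP h0.
  rewrite ltr_pdivrMr // => H.
  apply: le_lt_trans (lt_le_trans H _); last first.
    by rewrite mulrC ler_wpM2l ?(ltW d0) // ler_nat.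
  rewrite mulrA ler_wpM2r ?nrm_ge0 // ler_wpM2r //; exact: ler_norm.
(* If the means have norm at most m + 2 d, the parallelogram law bounds the square
   of the norm of their difference by 4 (m + 2 d)^2 - 4 m^2 = d (16 m + 16 d). *)
pose d := Num.min 1 (e ^+ 2 / (16 * m + 17)).
have den : 0 < 16 * m + 17 by lra.
have d0 : 0 < d by rewrite lt_min ltr01 divr_gt0 // exprn_gt0.
have d1 : d <= 1 by rewrite ge_min lexx.
have de : d * (16 * m + 17) <= e ^+ 2.
  by rewrite -ler_pdivlMr // ge_min lexx orbT.
have [_ [n _ <-] Hn] := inf_adherent d0 infE.
have [n0 Hn0] := small n.+1%:R d d0.
have close N : (n0 <= N)%N -> (0 < N)%N -> nrm (mean W N v) < m + 2 * d.
  move=> nN N0.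
  apply: le_lt_trans (nrm_le_add _ (mean W N (mean W n.+1 v))) _.
  rewrite nrmBC.
  have := mean_mean N v (ltn0Sn n); have := Hn0 N nN N0; have := nrm_mean N (mean W n.+1 v).
  rewrite -/m in Hn; lra.
have low N M : (0 < N)%N -> (0 < M)%N -> 2 * m <= nrm (mean W N v + mean W M v).
  move=> N0 M0; apply/ler_addgt0Pr => x x0.
  have [P0 HP0] := small (N%:R + M%:R) x x0.
  have := HP0 P0.+1 (leqnSn _) isT; have := m_le P0.+1 isT.
  set P := P0.+1 => mP HP.
  have := nrm_mean P (mean W N v + mean W M v); rewrite meanD.
  have := nrm_le_add (mean W P v + mean W P v) (mean W P (mean W N v) + mean W P (mean W M v)).
  have := mean_mean P v N0; have := mean_mean P v M0.
  rewrite ![nrm (mean W P (mean W _ v) - _)]nrmBC.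
  have -> : mean W P v + mean W P v - (mean W P (mean W N v) + mean W P (mean W M v)) =
      (mean W P v - mean W P (mean W N v)) + (mean W P v - mean W P (mean W M v)).
    by rewrite opprD addrACA.
  have := nrmD (mean W P v - mean W P (mean W N v)) (mean W P v - mean W P (mean W M v)).
  have -> : mean W P v + mean W P v = (2%:R : R)%:C *: mean W P v.
    by rewrite rmorph_nat scaler_nat mulr2n.
  rewrite nrmZr // mulrDl in HP *; lra.
exists (maxn n0 1) => N M; rewrite !geq_max => /andP[nN N0] /andP[nM M0].
rewrite -(ltr_pXn2r (ltn0Sn 1)) ?nnegrE ?nrm_ge0 ?(ltW e0) //.
rewrite nrm_parallelogram.
have a1 := close N nN N0; have a2 := close M nM M0; have a3 := low N M N0 M0.
have b1 := nrm_ge0 (mean W N v); have b2 := nrm_ge0 (mean W M v).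
have c1 : nrm (mean W N v) ^+ 2 < (m + 2 * d) ^+ 2 by rewrite ltr_pXn2r ?nnegrE //; lra.
have c2 : nrm (mean W M v) ^+ 2 < (m + 2 * d) ^+ 2 by rewrite ltr_pXn2r ?nnegrE //; lra.
have c3 : (2 * m) ^+ 2 <= nrm (mean W N v + mean W M v) ^+ 2.
  by rewrite ler_pXn2r ?nnegrE //; lra.
nra.
Qed.

Lemma mean_limit_fixed v e : mean_limit W v e -> nrm (W e - e) = 0.
Proof.
move=> lim; apply/le_anti; rewrite nrm_ge0 andbT.
apply/ler_addgt0Pr => x x0; rewrite add0r.
have [n0 Hn0] := lim (x / 4) ltac:(lra).
have h0 : 0 <= 8 * nrm v / x by apply: divr_ge0; [rewrite mulr_ge0 ?nrm_ge0| exact: ltW].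
have := Num.Theory.archi_boundP h0; set b := Num.bound _ => Hb.
pose N := (maxn n0 b).+1.
have := Hn0 N (leq_trans (leq_maxl _ _) (leqnSn _)) => H1.
have : 2 * nrm v / N%:R <= x / 4.
  have : 8 * nrm v / x < N%:R.
    by apply: lt_le_trans Hb _; rewrite ler_nat (leq_trans (leq_maxr _ _) (leqnSn _)).
  rewrite ltr_pdivrMr // => H; rewrite ler_pdivrMr ?ltr0n //; lra.
move=> H2.
have := nrmB_tri (mean W N v) (W e) e.
have := nrmB_tri (W (mean W N v)) (W e) (mean W N v).
have := mean_shift N v; rewrite mean_comm -(isoB isoW) (iso_nrm isoW) [nrm (e - _)]nrmBC.
lra.
Qed.

Lemma dot_fixed v g : nrm (W g - g) = 0 -> dot (W v) g = dot v g.
Proof.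
move=> g0; rewrite -(iso_dot isoW v g) -[X in _ = dot _ X](subrK g (W g)) dotDr.
by rewrite (nrm0_dotr _ g0) add0r.
Qed.

Lemma dot_mean_fixed N v g : (0 < N)%N -> nrm (W g - g) = 0 ->
  dot (mean W N v) g = dot v g.
Proof.
move=> N0 g0; rewrite /mean dZ dot_suml.
have H n : dot (iter n W v) g = dot v g.
  by elim: n => //= n <-; rewrite dot_fixed.
under eq_bigr do rewrite H.
by rewrite sumr_const_nat subn0 -(mulr_natl (dot v g)) mulrA mulVf ?mul1r // pnatr_eq0 -lt0n.
Qed.

(** The limit of the means of v is its orthogonal projection on the fixed vectors. *)
Lemma dot_mean_limit v e g : mean_limit W v e -> nrm (W g - g) = 0 ->
  dot v g = dot e g.
Proof.
move=> lim g0; apply/eqP; rewrite -subr_eq0 -normr_le0.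
apply/ler_addgt0Pr => x x0; rewrite add0r.
have gp : 0 < nrm g + 1 by have := nrm_ge0 g; lra.
have [n0 Hn0] := lim (x / (nrm g + 1)) (divr_gt0 x0 gp).
have := Hn0 n0.+1 (leqnSn _).
rewrite -(@dot_mean_fixed n0.+1 v g) // -dotBl.
set u := mean _ _ _ - _ => H.
apply: le_trans (cauchy_schwarz _ _) _.
move: H; rewrite ltr_pdivlMr // => H.
apply: le_trans (ltW H); rewrite ler_wpM2l ?nrm_ge0 //; lra.
Qed.

(** A mean of length k * N is an average of k isometric images of the mean of length
N.  Divisibility thus replaces monotonicity in N. *)
Lemma mean_mul k N v : (0 < N)%N -> nrm (mean W (k * N) v) <= nrm (mean W N v).
Proof.
move=> N0; have [->|k0] := posnP k.
  by rewrite mul0n /mean big_geq // scaler0 nrm0 nrm_ge0.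
have -> : mean W (k * N) v = mean (iter N W) k (mean W N v).
  rewrite /mean natrM invfM rmorphM /= -scalerA; congr (_ *: _).
  rewrite scaler_sumr big_nat_mul; apply: eq_bigr => j _ /=.
  rewrite -iterM (isoZ (isometry_iter _ isoW)) -scaler_sumr; congr (_ *: _).
  rewrite (iso_sum (isometry_iter _ isoW)) -{1}[(j * N)%N]add0n big_addn.
  rewrite mulSn addnK; apply: eq_bigr => i _.
  by rewrite -iterD addnC.
rewrite {1}/mean nrmZr ?invr_ge0 ?ler0n // mulrC ler_pdivrMr ?ltr0n //.
apply: le_trans (nrm_sum _ _ _) _.
have -> : nrm (mean W N v) * k%:R = \sum_(0 <= i < k) nrm (mean W N v).
  by rewrite sumr_const_nat subn0 mulr_natr.
apply: ler_sum => i _; rewrite -iterM.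
by rewrite iter_iso_nrm.
Qed.

End MeanErgodic.
End InnerProduct.

(** * Eigenvectors as fixed vectors of rotated isometries *)
Section Eigenvectors.
Context {R : realType} {V : lmodType R[i]}.
Variables (dot : V -> V -> R) (U : V -> V).
Hypothesis dotP : inner_product dot.
Hypothesis isoU : isometry dot U.
Local Notation nrm := (nrm dot).

(** A unimodular eigenvalue is handled through its conjugate z: an eigenvector is a
vector fixed by [rot z] up to a null vector. *)
Definition rot (z : R[i]) (u : V) : V := z *: U u.

Lemma isometry_rotU z : unimodular z -> isometry dot (rot z).
Proof. by move=> z1; exact: isometry_rot. Qed.

Lemma dotZZc (z y : R[i]) u v : dot (z *: u) (y *: v) =
  (complex.Re z * complex.Re y + complex.Im z * complex.Im y) * dot u v +
  (complex.Re z * complex.Im y - complex.Im z * complex.Re y) * dot u ('i *: v).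
Proof.
rewrite (dotZl dotP) (dotZr dotP y u v) scalerA (mulrC _ y) -scalerA.
rewrite (dotZr dotP y u) ii_scale (dotNr dotP); ring.
Qed.

Lemma nrmZ0 z u : nrm u = 0 -> nrm (z *: u) = 0.
Proof.
move=> u0; have : nrm (z *: u) ^+ 2 = 0.
  by rewrite (nrm_sqr dotP) (dotZZ dotP) -(nrm_sqr dotP) u0 expr0n /= mulr0.
by move/eqP; rewrite expf_eq0 /= => /eqP.
Qed.

Lemma fixedZ z a g : nrm (rot z g - g) = 0 -> nrm (rot z (a *: g) - a *: g) = 0.
Proof.
move=> g0; rewrite /rot (isoZ isoU) scalerA mulrC -scalerA -scalerBr.
exact: nrmZ0.
Qed.

Lemma fixed_iter z g k : nrm (rot z g - g) = 0 ->
  nrm (rot z (iter k U g) - iter k U g) = 0.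
Proof.
move=> g0; have := iter_iso_nrm isoU k (rot z g - g).
by rewrite g0 /rot (isoB (isometry_iter k isoU)) (isoZ (isometry_iter k isoU)) -iterSr.
Qed.

Lemma dot_null_eq a b x y : nrm (a - x) = 0 -> nrm (b - y) = 0 ->
  dot a b = dot x y.
Proof.
move=> ax by_; apply/eqP; rewrite -subr_eq0.
have -> : dot a b - dot x y = dot (a - x) b + dot x (b - y).
  by rewrite (dotBl dotP) (dotBr dotP); ring.
by rewrite (nrm0_dotl dotP _ ax) (nrm0_dotr dotP _ by_) addr0.
Qed.

(** Invariance under U replaces the Hermitian product <g, h> by <g, h> times z times
the conjugate of y, and this factor is not 1.  In terms of real parts, this is a
homogeneous linear system in [dot g h] and [dot g ('i *: h)], with determinant
(1 - p)^2 + q^2 for the factor p + q i, up to the sign of q. *)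
Lemma fixed_orth z y g h : unimodular z -> unimodular y -> z != y ->
  nrm (rot z g - g) = 0 -> nrm (rot y h - h) = 0 -> dot g h = 0.
Proof.
move=> z1 y1 zy g0 h0.
have key k : nrm (rot y k - k) = 0 -> dot g k =
  (complex.Re z * complex.Re y + complex.Im z * complex.Im y) * dot g k +
  (complex.Re z * complex.Im y - complex.Im z * complex.Re y) * dot g ('i *: k).
  move=> k0; rewrite -{1}(dot_null_eq g0 k0) /rot dotZZc.
  by rewrite -(isoZ isoU) !(iso_dot isoU).
have := key _ h0; have := key _ (fixedZ 'i h0).
rewrite ii_scale (dotNr dotP).
move: (dot g h) (dot g ('i *: h)) => s t.
move: z1 y1 zy; rewrite /unimodular.
case: z y {g0 h0 key} => [a b] [c d] /= z1 y1 zy Ht Hs.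
pose p := a * c + b * d; pose q := a * d - b * c.
rewrite -/p -/q in Ht Hs.
have : ((1 - p) ^+ 2 + q ^+ 2) * s = 0.
  have -> : ((1 - p) ^+ 2 + q ^+ 2) * s = (1 - p) * (s - (p * s + q * t)) +
    q * (t - (p * t + q * - s)) by ring.
  by rewrite -Hs -Ht !subrr !mulr0 addr0.
move/eqP; rewrite mulf_eq0 => /orP[/eqP pq|/eqP //].
have p1 : p = 1.
  have : (1 - p) ^+ 2 = 0.
    by apply/le_anti; rewrite sqr_ge0 -[X in _ <= X]pq lerDl sqr_ge0.
  by move/eqP; rewrite sqrf_eq0 subr_eq0 => /eqP.
have : (a - c) ^+ 2 + (b - d) ^+ 2 = 0 by rewrite /p in p1; lra.
move=> ac.
have ac1 : (a - c) ^+ 2 = 0.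
  by apply/le_anti; rewrite sqr_ge0 -[X in _ <= X]ac lerDl sqr_ge0.
have bd1 : (b - d) ^+ 2 = 0 by rewrite ac1 add0r in ac.
move: ac1 bd1 zy => /eqP; rewrite sqrf_eq0 subr_eq0 => /eqP -> /eqP.
by rewrite sqrf_eq0 subr_eq0 => /eqP -> /eqP.
Qed.

Variable E : R[i] -> V -> V.
Hypothesis limE : forall z v, unimodular z -> mean_limit dot (rot z) v (E z v).

Lemma fixedE z v : unimodular z -> nrm (rot z (E z v) - E z v) = 0.
Proof. by move=> z1; apply: mean_limit_fixed (limE v z1) => //; exact: isometry_rotU. Qed.

Lemma dotE z v g : unimodular z -> nrm (rot z g - g) = 0 -> dot v g = dot (E z v) g.
Proof.
by move=> z1 g0; apply: (dot_mean_limit dotP (isometry_rotU z1)) => //; exact: limE.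
Qed.

Lemma dotE_sum (s : seq R[i]) z v g : uniq s -> (forall y, y \in s -> unimodular y) ->
  unimodular z -> nrm (rot z g - g) = 0 ->
  dot (\sum_(y <- s) E y v) g = if z \in s then dot v g else 0.
Proof.
move=> us s1 z1 g0; rewrite (dot_suml dotP).
have orth y : y \in s -> y != z -> dot (E y v) g = 0.
  by move=> /s1 y1 yz; apply: (fixed_orth y1 z1 yz _ g0); exact: fixedE.
case: ifPn => zs.
  rewrite (bigD1_seq z) //= big_seq_cond big1 ?addr0; first by rewrite -dotE.
  by move=> y /andP[]; exact: orth.
rewrite big_seq big1 // => y ys; apply: orth => //.
by apply: contraNneq zs => <-.
Qed.

Lemma bessel (s : seq R[i]) v : uniq s -> (forall y, y \in s -> unimodular y) ->
  \sum_(z <- s) nrm (E z v) ^+ 2 <= nrm v ^+ 2.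
Proof.
move=> us s1; set P := \sum_(z <- s) E z v.
have H x : (x = v \/ x = P) -> dot x P = \sum_(z <- s) nrm (E z v) ^+ 2.
  move=> xP; rewrite {1}/P (dot_sumr dotP) big_seq [RHS]big_seq.
  apply: eq_bigr => z zs; rewrite (nrm_sqr dotP) -(dotE v (s1 z zs) (fixedE v (s1 z zs))).
  case: xP => -> //.
  by rewrite (dotE_sum _ us s1 (s1 z zs)) ?zs //; apply: fixedE; exact: s1.
have := dot_ge0 dotP (v - P).
rewrite (dotBl dotP) !(dotBr dotP) [dot P v](dotC dotP) (H v) ?(H P); [|by right|by left].
by rewrite (nrm_sqr dotP); lra.
Qed.

(** By [bessel] a list of unimodular numbers whose projections of v have norm at
least d has at most |v|^2 / d^2 entries; the list s is one of maximal length. *)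
Lemma finite_spectrum v (d : R) : 0 < d -> exists s : seq R[i],
  [/\ uniq s, forall z, z \in s -> unimodular z /\ d <= nrm (E z v)
    & forall z, unimodular z -> z \notin s -> nrm (E z v) < d].
Proof.
move=> d0.
pose Q k := `[< exists s : seq R[i], [/\ size s = k, uniq s &
   forall z, z \in s -> unimodular z /\ d <= nrm (E z v)] >].
have Q0 : exists k, Q k by exists 0%N; apply/asboolP; exists [::].
have Qb k : Q k -> (k <= Num.bound (nrm v ^+ 2 / d ^+ 2))%N.
  move=> /asboolP[s [<- us sH]].
  have := bessel v us (fun z zs => (sH z zs).1).
  have : (size s)%:R * d ^+ 2 <= \sum_(z <- s) nrm (E z v) ^+ 2.
    have -> : (size s)%:R * d ^+ 2 = \sum_(z <- s) d ^+ 2.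
      by rewrite big_const_seq count_predT iter_addr_0 mulr_natl.
    rewrite big_seq [X in _ <= X]big_seq; apply: ler_sum => z zs.
    by rewrite ler_pXn2r ?nnegrE ?(ltW d0) ?(nrm_ge0) //; exact: (sH z zs).2.
  move=> h1 h2; have := le_trans h1 h2; rewrite -ler_pdivlMr ?exprn_gt0 // => h3.
  rewrite -(ler_nat R); apply: le_trans h3 _; apply: ltW.
  by apply: archi_boundP; rewrite divr_ge0 // sqr_ge0.
case: (ex_maxnP Q0 Qb) => k /asboolP[s [sk us sH]] kmax.
exists s; split=> // z z1 zs; rewrite ltNge; apply/negP => dz.
suff : (k.+1 <= k)%N by rewrite ltnn.
apply: kmax; apply/asboolP; exists (z :: s); split => /=.
- by rewrite sk.
- by rewrite zs.
- by move=> y; rewrite inE => /orP[/eqP ->|/sH].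
Qed.

Section Remainder.
Variables (v : V) (s : seq R[i]).
Hypothesis us : uniq s.
Hypothesis s1 : forall z, z \in s -> unimodular z.
Let w := v - \sum_(z <- s) E z v.

Lemma remainder_orth z g : z \in s -> nrm (rot z g - g) = 0 -> dot w g = 0.
Proof.
move=> zs g0; rewrite (dotBl dotP) (dotE_sum v us s1 (s1 zs) g0) zs.
by rewrite subrr.
Qed.

Lemma remainder_iter_orth m z g : z \in s -> nrm (rot z g - g) = 0 ->
  dot (iter m U w) g = 0.
Proof.
move=> zs; elim: m g => [|m IH] g g0 /=; first exact: remainder_orth zs g0.
rewrite -(@dot_null_eq (U (iter m U w)) (rot z g)) ?subrr ?nrm0 //.
by rewrite /rot -(isoZ isoU) (iso_dot isoU) IH //; exact: fixedZ.
Qed.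

(** Projecting the remainder w on the eigenvectors fixed by [rot z] gives 0 if E z v
was subtracted, and E z v otherwise. *)
Lemma remainder_small (d : R) z : 0 <= d ->
  (forall y, unimodular y -> y \notin s -> nrm (E y v) < d) ->
  unimodular z -> nrm (E z w) <= d.
Proof.
move=> d0 small z1.
have e0 := fixedE w z1.
have e2 := nrm_sqr dotP (E z w); move: e2; rewrite -(dotE w z1 e0).
rewrite {2}/w (dotBl dotP) (dotE_sum v us s1 z1 e0).
case: ifPn => zs; first by rewrite subrr => /eqP; rewrite sqrf_eq0 => /eqP ->.
rewrite subr0 (dotE v z1 e0) => H.
have := cauchy_schwarz dotP (E z v) (E z w).
have := small z z1 zs; have := nrm_ge0 dot (E z w); have := ler_norm (dot (E z v) (E z w)).
rewrite -H; set x := nrm (E z w); set y := nrm (E z v) => h1 h2 h3 h4.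
have [//|dx] := leP x d.
have : x ^+ 2 <= y * x by exact: le_trans h1 h4.
by rewrite expr2 ler_pM2r //; lra.
Qed.

(** Along its whole orbit the remainder stays orthogonal to the subtracted
eigenvectors, so that U^k w can be replaced by U^k v in the correlation.  In
this way the closeness of the orbit of v serves for w, whatever was subtracted. *)
Lemma remainder_corr m k (e : R) : nrm (iter m U v - iter k U v) <= e ->
  nrm w ^+ 2 - e * nrm w <= dot (iter m U w) (iter k U w).
Proof.
move=> mk.
have proj j : dot (iter m U w) (iter j U w) = dot (iter m U w) (iter j U v).
  rewrite {2}/w (isoB (isometry_iter j isoU)) (dotBr dotP).
  rewrite (iso_sum (isometry_iter j isoU)) (dot_sumr dotP) big_seq big1 ?subr0 // => z zs.
  by apply: (remainder_iter_orth m zs); apply: fixed_iter; apply: fixedE; exact: s1.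
rewrite (nrm_sqr dotP) -(iso_dot (isometry_iter m isoU) w) !proj.
have := cauchy_schwarz dotP (iter m U w) (iter m U v - iter k U v).
have := ler_norm (dot (iter m U w) (iter m U v - iter k U v)).
rewrite (dotBr dotP) (iter_iso_nrm isoU).
have := nrm_ge0 dot w; move: (nrm (_ - _)) mk => n mk; move: (nrm w) => x x0.
have : x * n <= e * x by rewrite mulrC ler_wpM2r.
lra.
Qed.

End Remainder.
End Eigenvectors.
(** * Fourier analysis of a Gram matrix on the roots of unity *)
Section RootsOfUnity.
Context {R : realType}.

Definition circ (t : R) : R[i] := (cos t +i* sin t)%C.

Lemma circD s t : circ (s + t) = circ s * circ t.
Proof. by rewrite /circ cosD sinD; apply/eqP; rewrite eq_complex /= addrC eqxx [X in _ == X]addrC eqxx. Qed.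

Lemma circ0 : circ 0 = 1. Proof. by rewrite /circ cos0 sin0. Qed.

Lemma circ_nat n t : circ (n%:R * t) = circ t ^+ n.
Proof.
elim: n => [|n IH]; first by rewrite mul0r circ0 expr0.
by rewrite -natr1 mulrDl mul1r circD IH exprSr.
Qed.

Lemma circ_conj t : (circ t)^*%C = circ (- t).
Proof. by rewrite /circ cosN sinN. Qed.

Lemma circ2pi : circ (pi *+ 2) = 1.
Proof. by rewrite /circ cos2pi sin2pi. Qed.

Lemma circ_neq1 t : 0 < t < pi *+ 2 -> circ t != 1.
Proof.
move=> /andP[t0 t2]; apply/eqP => /(congr1 (@complex.Re R)) /= ct.
have : 0 < sin (t / 2) by apply: sin_gt0_pi; rewrite mulr2n in t2; lra.
move=> s0; move: ct; rewrite (splitr t) -mulr2n cos_mulr2n cos2sin2 => ct.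
have := exprn_gt0 2 s0; move: (sin _ ^+ 2) ct => x; rewrite mulr2n; lra.
Qed.

Variable M : nat.

Definition zeta (j : nat) : R[i] := circ (j%:R * (pi *+ 2 / M%:R)).

Lemma zeta_orth p q : (p < M)%N -> (q < M)%N ->
  \sum_(0 <= j < M) zeta j ^+ p * (zeta j ^+ q)^*%C = M%:R * (p == q)%:R.
Proof.
move=> pM qM; have M0 : (0 < M)%N by apply: leq_ltn_trans pM.
have Mn0 : M%:R != 0 :> R by rewrite pnatr_eq0 -lt0n.
pose a : R := pi *+ 2 / M%:R.
pose x : R[i] := circ (p%:R * a) * circ (- (q%:R * a)).
have E j : zeta j ^+ p * (zeta j ^+ q)^*%C = x ^+ j.
  rewrite /zeta -!circ_nat circ_conj -circD /x -circD -circ_nat; congr circ.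
  rewrite -/a; ring.
under eq_bigr do rewrite E.
have [pq|pq] := eqVneq p q.
  rewrite mulr1 /x pq -circD; under eq_bigr do rewrite subrr circ0 expr1n.
  by rewrite sumr_const_nat subn0.
rewrite mulr0.
have xM : x ^+ M = 1.
  have Ma k : M%:R * (k%:R * a) = k%:R * (pi *+ 2).
    by rewrite mulrCA /a [M%:R * _]mulrC divfK.
  rewrite exprMn -!circ_nat mulrN -circ_conj !Ma.
  by rewrite !circ_nat circ2pi !expr1n conjc1 mulr1.
have x1 : x != 1.
  have lt k l : (k < l)%N -> (l < M)%N -> circ (l%:R * a - k%:R * a) != 1.
    move=> kl lM; apply: circ_neq1; rewrite -mulrBl -natrB ?(ltnW kl) //.
    have pp : (0 : R) < pi *+ 2 by rewrite mulrn_wgt0 // pi_gt0.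
    rewrite /a mulrA; apply/andP; split.
      by rewrite divr_gt0 ?ltr0n // mulr_gt0 ?ltr0n ?subn_gt0.
    rewrite ltr_pdivrMr ?ltr0n // mulrC ltr_pM2l // ltr_nat.
    exact: leq_ltn_trans (leq_subr _ _) lM.
  rewrite /x -circD; case: (ltngtP p q) => [h|h|h].
  - apply: contraNneq (lt _ _ h qM) => h1.
    by rewrite -opprB -circ_conj h1 conjc1.
  - exact: lt.
  - by rewrite h eqxx in pq.
have := subrX1 x M; rewrite xM subrr => /esym/eqP.
by rewrite mulf_eq0 subr_eq0 (negPf x1) /= big_mkord => /eqP.
Qed.

End RootsOfUnity.

Section Fourier.
Context {R : realType}.
Variables (N : nat) (h : nat -> nat -> R[i]).
Let M := (N + N)%N.
Let z j : R[i] := zeta M j.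

(** For h the Gram matrix of vectors u_m this is the squared norm of the exponential
sum of the u_m at the root of unity z j, see [gramsum_dot].  The order of the
roots is 2N and not N, so that m + m' and k + k' below are congruent modulo the
order only if they are equal. *)
Definition gramsum (j : nat) : R[i] :=
  \sum_(0 <= m < N) \sum_(0 <= k < N) z j ^+ m * (z j ^+ k)^*%C * h m k.

Lemma gramsum_mean :
  \sum_(0 <= j < M) gramsum j = M%:R * \sum_(0 <= m < N) h m m.
Proof.
rewrite /gramsum exchange_big /= mulr_sumr; apply: eq_big_nat => m /andP[_ mN].
rewrite exchange_big /=.
have mM : (m < M)%N by rewrite (leq_trans mN) // leq_addr.
under eq_big_nat => k /andP[_ kN].
  have kM : (k < M)%N by rewrite (leq_trans kN) // leq_addr.
  rewrite -mulr_suml zeta_orth //; over.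
rewrite (bigD1_seq m) ?mem_index_iota ?iota_uniq //= eqxx mulr1 big1 ?addr0 // => k km.
by rewrite eq_sym (negPf km) mulr0 mul0r.
Qed.

Lemma gramsum_sqr_mean :
  \sum_(0 <= j < M) gramsum j ^+ 2 = M%:R *
   \sum_(0 <= m < N) \sum_(0 <= k < N) \sum_(0 <= m' < N) \sum_(0 <= k' < N)
     (m + m' == k + k')%N%:R * (h m k * h m' k').
Proof.
have E j : gramsum j ^+ 2 =
    \sum_(0 <= m < N) \sum_(0 <= k < N) \sum_(0 <= m' < N) \sum_(0 <= k' < N)
     z j ^+ (m + m') * (z j ^+ (k + k'))^*%C * (h m k * h m' k').
  rewrite expr2 /gramsum mulr_suml; apply: eq_bigr => m _.
  rewrite mulr_suml; apply: eq_bigr => k _.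
  rewrite mulr_sumr; apply: eq_bigr => m' _.
  rewrite mulr_sumr; apply: eq_bigr => k' _.
  by rewrite !exprD rmorphM /=; ring.
under eq_bigr do rewrite E.
rewrite exchange_big /= mulr_sumr; apply: eq_big_nat => m /andP[_ mN].
rewrite exchange_big /= mulr_sumr; apply: eq_big_nat => k /andP[_ kN].
rewrite exchange_big /= mulr_sumr; apply: eq_big_nat => m' /andP[_ mN'].
rewrite exchange_big /= mulr_sumr; apply: eq_big_nat => k' /andP[_ kN'].
by rewrite -mulr_suml zeta_orth ?mulrA // /M -addSn leq_add // ltnW.
Qed.

End Fourier.

Section Hermitian.
Context {R : realType} {V : lmodType R[i]}.
Variables (dot : V -> V -> R).
Hypothesis dotP : inner_product dot.

(** The Hermitian form whose real part is [dot]. *)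
Definition hdot (u v : V) : R[i] := (dot u v +i* dot u ('i *: v))%C.

Lemma hdotC u v : hdot v u = (hdot u v)^*%C.
Proof.
by rewrite /hdot /= (dotC dotP v u) (dotC dotP v) (dot_il dotP).
Qed.

Lemma hdotDl u v w : hdot (u + v) w = hdot u w + hdot v w.
Proof. by rewrite /hdot !(dotDl dotP). Qed.

Lemma hdotZl z u v : hdot (z *: u) v = z * hdot u v.
Proof.
rewrite /hdot !(dotZl dotP) ii_scale (dotNr dotP); case: z => a b.
by apply/eqP; rewrite eq_complex /= !mulrN opprK !eqxx.
Qed.

Lemma hdotDr u v w : hdot w (u + v) = hdot w u + hdot w v.
Proof. by rewrite !(hdotC _ w) hdotDl rmorphD. Qed.

Lemma hdotZr z u v : hdot u (z *: v) = (z^*)%C * hdot u v.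
Proof.
by rewrite !(hdotC _ u) hdotZl rmorphM. Qed.

Lemma hdot_suml (I : Type) (s : seq I) (F : I -> V) v :
  hdot (\sum_(i <- s) F i) v = \sum_(i <- s) hdot (F i) v.
Proof.
elim/big_rec2: _ => [|i a b _ <-]; last by rewrite hdotDl.
by rewrite -(scale0r 0) hdotZl mul0r.
Qed.

Lemma hdot_sumr (I : Type) (s : seq I) (F : I -> V) v :
  hdot v (\sum_(i <- s) F i) = \sum_(i <- s) hdot v (F i).
Proof.
elim/big_rec2: _ => [|i a b _ <-]; last by rewrite hdotDr.
by rewrite -(scale0r 0) hdotZr conjc0 mul0r.
Qed.

Lemma hdotuu u : hdot u u = (dot u u)%:C%C.
Proof.
have H : dot u ('i *: u) = 0.
  have := dot_il dotP u u; rewrite (dotC dotP).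
  by move/eqP; rewrite -subr_eq0 opprK -mulr2n mulrn_eq0 => /eqP.
by rewrite /hdot H.
Qed.

End Hermitian.

Lemma ler_sum_subrange (R : numDomainType) (F : nat -> R) (a b n : nat) :
  (forall i, 0 <= F i) -> (b <= n)%N ->
  \sum_(a <= i < b) F i <= \sum_(0 <= i < n) F i.
Proof.
move=> F0 bn; have [ab|ba] := leqP a b; last first.
  by rewrite big_geq ?(ltnW ba) // sumr_ge0.
rewrite (@big_cat_nat _ _ _ b 0%N n) //= (@big_cat_nat _ _ _ a 0%N b) //=.
by rewrite addrAC lerDr addr_ge0 // sumr_ge0.
Qed.

Section WienerBound.
Context {R : realType} {V : lmodType R[i]}.
Variables (dot : V -> V -> R) (U : V -> V).
Hypothesis dotP : inner_product dot.
Hypothesis isoU : isometry dot U.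
Local Notation nrm := (nrm dot).
Variables (w : V).
Let u n := iter n U w.
Let b m k : R := dot (u m) (u k).

Lemma iter_rot z n v : iter n (rot U z) v = z ^+ n *: iter n U v.
Proof.
elim: n => [|n IH]; first by rewrite expr0 scale1r.
by rewrite /= IH /rot (isoZ isoU) scalerA exprS.
Qed.

Lemma hdot_iter d m k : hdot dot (u (m + d)) (u (k + d)) = hdot dot (u m) (u k).
Proof.
have isod := isometry_iter d isoU.
rewrite /u !(addnC _ d) !iterD /hdot (iso_dot isod); congr (_ +i* _)%C.
by rewrite -(isoZ isod) (iso_dot isod).
Qed.

Lemma dot_iter d m k : b (m + d) (k + d) = b m k.
Proof. by have [] := hdot_iter d m k. Qed.

Lemma unimodular_circ (t : R) : unimodular (circ t).
Proof. exact: cos2Dsin2. Qed.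

Variables (N : nat) (D : R).
Hypothesis N0 : (0 < N)%N.
Hypothesis mean_le : forall t : R, 0 <= t <= pi *+ 2 ->
  nrm (mean (rot U (circ t)) N w) <= D.

Let h m k := hdot dot (u m) (u k).
Let z j : R[i] := zeta (N + N) j.
Let S j := \sum_(0 <= n < N) z j ^+ n *: u n.

Lemma gramsum_dot j : gramsum N h j = (dot (S j) (S j))%:C%C.
Proof.
rewrite -(hdotuu dotP) /gramsum /S (hdot_suml dotP); apply: eq_bigr => m _.
rewrite (hdot_sumr dotP); apply: eq_bigr => k _.
by rewrite (hdotZl dotP) (hdotZr dotP) mulrA.
Qed.

Lemma nrm_S j : (j < N + N)%N -> dot (S j) (S j) <= (N%:R * D) ^+ 2.
Proof.
move=> jM; have pp : 0 <= pi *+ 2 :> R by rewrite mulrn_wge0 // pi_ge0.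
rewrite -(nrm_sqr dotP) ler_pXn2r ?nnegrE ?nrm_ge0 //; last first.
  by rewrite mulr_ge0 // (le_trans (nrm_ge0 dot _) (mean_le (t := 0) _)) // lexx.
have M0 : 0 < (N + N)%:R :> R by rewrite ltr0n addn_gt0 N0.
have t01 : 0 <= (j%:R * (pi *+ 2 / (N + N)%:R) : R) <= pi *+ 2.
  apply/andP; split; first by apply: mulr_ge0 => //; apply: divr_ge0.
  rewrite mulrCA -[X in _ <= X]mulr1; apply: ler_wpM2l => //.
  by rewrite ler_pdivrMr // mul1r ler_nat ltnW.
have := mean_le t01.
rewrite /mean (nrmZr dotP) ?invr_ge0 ?ler0n // mulrC ler_pdivrMr ?ltr0n // [D * _]mulrC.
by under eq_bigr do rewrite iter_rot.
Qed.

(** A finite form of Wiener's lemma.  Let G(z) be the squared norm of the sum of the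
z^n U^n w over n < N.  Over the roots of unity of order 2N, the mean of G^2 is
the sum of the |<U^m w, U^k w>|^2, since for m + m' = k + k' the products
<U^m w, U^k w> and <U^m' w, U^k' w> are conjugate, while the mean of G is
N |w|^2.  It remains to bound one factor of G^2 by its supremum, and the real
parts of the products by their moduli. *)
Lemma fourth_moment_le :
  \sum_(0 <= m < N) \sum_(0 <= k < N) \sum_(0 <= m' < N) \sum_(0 <= k' < N)
     (m + m' == k + k')%N%:R * b m k ^+ 2 <=
  (N%:R * D) ^+ 2 * (N%:R * nrm w ^+ 2).
Proof.
set Q := \sum_(0 <= m < N) _.
have M0 : 0 < (N + N)%:R :> R by rewrite ltr0n addn_gt0 N0.
have E1 : \sum_(0 <= j < N + N) dot (S j) (S j) = (N + N)%:R * (N%:R * nrm w ^+ 2).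
  have := gramsum_mean N h; under eq_bigr do rewrite gramsum_dot.
  have -> : \sum_(0 <= m < N) h m m = (N%:R * nrm w ^+ 2)%:C%C.
    have H m : h m m = (nrm w ^+ 2)%:C%C.
      by rewrite /h (hdotuu dotP) /u (iso_dot (isometry_iter m isoU)) -(nrm_sqr dotP).
    under eq_bigr do rewrite H.
    by rewrite sumr_const_nat subn0 mulr_natl rmorphMn.
  rewrite -(rmorph_nat (real_complex R)) -rmorphM -rmorph_sum /=.
  by move=> /(congr1 (@complex.Re R)).
have E2 : (N + N)%:R * Q <= \sum_(0 <= j < N + N) dot (S j) (S j) ^+ 2.
  have := gramsum_sqr_mean N h; under eq_bigr do rewrite gramsum_dot -rmorphXn.
  have -> : \sum_(0 <= m < N) \sum_(0 <= k < N) \sum_(0 <= m' < N) \sum_(0 <= k' < N)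
     (m + m' == k + k')%N%:R * (h m k * h m' k') =
     (\sum_(0 <= m < N) \sum_(0 <= k < N) \sum_(0 <= m' < N) \sum_(0 <= k' < N)
     (m + m' == k + k')%N%:R *
       (complex.Re (h m k) ^+ 2 + complex.Im (h m k) ^+ 2))%:C%C.
    rewrite rmorph_sum; apply: eq_bigr => m _; rewrite rmorph_sum; apply: eq_bigr => k _.
    rewrite rmorph_sum; apply: eq_bigr => m' _; rewrite rmorph_sum; apply: eq_bigr => k' _.
    have [mk|_] := eqVneq (m + m')%N (k + k')%N; last by rewrite !mul0r.
    rewrite !mul1r.
    have -> : h m' k' = (h m k)^*%C.
      rewrite -(hdotC dotP) /h -(hdot_iter m) -(hdot_iter k' k m) addnC mk.
      by rewrite (addnC k' m).
    by case: (h m k) => x y; apply/eqP; rewrite eq_complex /=; apply/andP; split; apply/eqP; ring.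
  rewrite -(rmorph_nat (real_complex R)) -rmorphM -rmorph_sum /=.
  move=> /(congr1 (@complex.Re R)) /= ->; rewrite ler_pM2l //.
  apply: ler_sum => m _; apply: ler_sum => k _; apply: ler_sum => m' _.
  apply: ler_sum => k' _; rewrite ler_wpM2l ?ler0n //= lerDl; exact: sqr_ge0.
rewrite -(ler_pM2l M0); apply: le_trans E2 _.
rewrite mulrCA -E1 mulr_sumr; apply: ler_sum_nat => j /andP[_ jM].
by rewrite expr2 ler_wpM2r ?(dot_ge0 dotP) // nrm_S.
Qed.

End WienerBound.

Section WienerLower.
Context {R : realType}.
Variable b : nat -> nat -> R.
Hypothesis bD : forall d m k, b (m + d) (k + d) = b m k.
Variable K : nat.

(** Each n < K contributes through the K^2 quadruples (k + n, k, m', m' + n). *)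
Lemma fourth_moment_ge :
  K%:R * (K%:R * \sum_(0 <= n < K) b n 0 ^+ 2) <=
  \sum_(0 <= m < K + K) \sum_(0 <= k < K + K) \sum_(0 <= m' < K + K)
    \sum_(0 <= k' < K + K) (m + m' == k + k')%N%:R * b m k ^+ 2.
Proof.
have pos m k m' k' : 0 <= (m + m' == k + k')%N%:R * b m k ^+ 2.
  by rewrite mulr_ge0 ?ler0n ?sqr_ge0.
rewrite exchange_big /=.
apply: (@le_trans _ _ (\sum_(0 <= k < K) \sum_(k <= m < k + K)
    \sum_(0 <= m' < K + K) \sum_(0 <= k' < K + K) (m + m' == k + k')%N%:R * b m k ^+ 2)).
  have -> : K%:R * (K%:R * \sum_(0 <= n < K) b n 0 ^+ 2) =
      \sum_(0 <= k < K) K%:R * \sum_(0 <= n < K) b n 0 ^+ 2.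
    by rewrite sumr_const_nat subn0 mulr_natl.
  apply: ler_sum_nat => k /andP[_ kK].
  rewrite -{1}[k]add0n big_addn addKn mulr_sumr.
  apply: ler_sum_nat => n /andP[_ nK].
  have -> : K%:R * b n 0 ^+ 2 = \sum_(0 <= m' < K) b (n + k) k ^+ 2.
    by rewrite -[in LHS](bD k) add0n sumr_const_nat subn0 mulr_natl.
  apply: le_trans (_ : _ <= \sum_(0 <= m' < K) _) (ler_sum_subrange _ _ (leq_addl _ _)).
    apply: ler_sum_nat => m' /andP[_ mK].
    rewrite (bigD1_seq (n + m')%N) ?iota_uniq ?mem_index_iota //=; last first.
      by rewrite -addSn leq_add // ltnW.
    rewrite addnAC (addnC k) addnAC eqxx mul1r lerDl; exact: sumr_ge0.
  by move=> i; exact: sumr_ge0.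
apply: le_trans (ler_sum_subrange 0 _ (leq_addl K K)); last first.
  by move=> k; do 3 (apply: sumr_ge0 => ? _).
apply: ler_sum_nat => k /andP[_ kK].
apply: ler_sum_subrange; last by rewrite leq_add2r ltnW.
by move=> m; do 2 (apply: sumr_ge0 => ? _).
Qed.

(** For each colour, the differences of the times of that colour with the smallest of
them are distinct, and each carries a squared correlation at least B.  The bound
is the sum of these estimates over the colours, which share the K times. *)
Lemma pigeonhole_corr (J : finType) (c : nat -> J) (B : R) : 0 <= B ->
  (forall m k, c m = c k -> B <= b m k ^+ 2) ->
  K%:R * B <= #|J|%:R * \sum_(0 <= n < K) b n 0 ^+ 2.
Proof.
move=> B0 Hc.
have -> : K%:R * B = \sum_(j : J) \sum_(0 <= i < K | c i == j) B.
  rewrite (exchange_big_dep predT) //=.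
  have H i : \sum_(j | c i == j) B = B by rewrite (big_pred1 (c i)).
  by under eq_bigr do rewrite H; rewrite sumr_const_nat subn0 mulr_natl.
have -> : #|J|%:R * \sum_(0 <= n < K) b n 0 ^+ 2 =
    \sum_(j : J) \sum_(0 <= n < K) b n 0 ^+ 2.
  by rewrite sumr_const mulr_natl.
apply: ler_sum => j _.
have [|no] := pselect (exists i, (i < K)%N && (c i == j)); last first.
  rewrite big_nat_cond big1 ?sumr_ge0 // => [n _|i /andP[/andP[_ iK] ij]]; first exact: sqr_ge0.
  by case: no; exists i; rewrite iK ij.
move=> ex; case: (ex_minnP ex) => i0 /andP[i0K /eqP ci0] imin.
rewrite (@big_cat_nat _ _ _ i0 0%N K) //=; last exact: ltnW.
rewrite [X in X + _]big_nat_cond big1 ?add0r; last first.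
  move=> i /andP[/andP[_ ii0] ij].
  by have := imin i; rewrite ij (ltn_trans ii0 i0K) leqNgt ii0 => /(_ isT).
apply: (@le_trans _ _ (\sum_(i0 <= i < K) b (i - i0) 0 ^+ 2)).
  rewrite big_mkcond /=; apply: ler_sum_nat => i /andP[i0i iK].
  case: ifP => [/eqP cij|_]; last exact: sqr_ge0.
  by rewrite -(bD i0) subnK // add0n; apply: Hc; rewrite ci0.
rewrite -{1}(add0n i0) big_addn; under eq_bigr do rewrite addnK.
apply: ler_sum_subrange => [n|]; [exact: sqr_ge0 | exact: leq_subr].
Qed.

End WienerLower.

(** * Vectors with precompact orbit are limits of sums of eigenvectors *)
Section Uniformity.
Context {R : realType} {V : lmodType R[i]}.
Variables (dot : V -> V -> R) (U : V -> V).
Hypothesis dotP : inner_product dot.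
Hypothesis isoU : isometry dot U.
Local Notation nrm := (nrm dot).

Lemma nrm_scale_real (a : R) u : nrm (a%:C *: u) = `|a| * nrm u.
Proof.
have [a0|a0] := ger0P a; first exact: nrmZr.
have -> : a%:C = - (- a)%:C by rewrite rmorphN opprK.
by rewrite scaleNr (nrmN dotP) (nrmZr dotP) // oppr_ge0 ltW.
Qed.

Lemma nrm_scale_le (z : R[i]) u :
  nrm (z *: u) <= (`|complex.Re z| + `|complex.Im z|) * nrm u.
Proof.
rewrite scaleReIm mulrDl; apply: le_trans (nrmD dotP _ _) _.
rewrite !nrm_scale_real [nrm ('i *: u)](_ : _ = nrm u) //.
by rewrite /nrm (dot_ii dotP).
Qed.

Lemma orbit_sum_near N w (t e : R) : 0 < e ->
  \forall s \near t,
    nrm (\sum_(0 <= n < N) iter n (rot U (circ s)) w -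
         \sum_(0 <= n < N) iter n (rot U (circ t)) w) < e.
Proof.
elim: N e => [|N IH] e e0.
  by near=> s; rewrite !big_geq // subrr (nrm0 dotP).
have aux (x a b : R) : 0 <= x -> 0 <= a -> 0 <= b ->
    a * (x + 1) < e / 4 -> b * (x + 1) < e / 4 -> (a + b) * x < e / 2.
  by move=> x0 a0 b0 ha hb; lra.
have e2 : 0 < e / 2 by lra.
have w1 : 0 < nrm w + 1 by have := nrm_ge0 dot w; lra.
have e4 : 0 < e / 4 / (nrm w + 1) by apply: divr_gt0; lra.
have cN : (fun s : R => N%:R * s) @ t --> N%:R * t by exact: mulrl_continuous.
have /cvgrPdist_lt/(_ _ e4) Hc : (fun s => cos (N%:R * s)) @ t --> cos (N%:R * t).
  by apply: (cvg_comp _ _ cN); exact: continuous_cos.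
have /cvgrPdist_lt/(_ _ e4) Hs : (fun s => sin (N%:R * s)) @ t --> sin (N%:R * t).
  by apply: (cvg_comp _ _ cN); exact: continuous_sin.
near=> s.
rewrite !big_nat_recr //= opprD addrACA; apply: le_lt_trans (nrmD dotP _ _) _.
rewrite (splitr e); apply: ltrD; first by near: s; exact: IH.
rewrite !(iter_rot isoU) -!circ_nat -scalerBl; apply: le_lt_trans (nrm_scale_le _ _) _.
rewrite (iter_iso_nrm isoU) /=.
have hc : `|cos (N%:R * s) - cos (N%:R * t)| < e / 4 / (nrm w + 1).
  by rewrite distrC; near: s; exact: Hc.
have hs : `|sin (N%:R * s) - sin (N%:R * t)| < e / 4 / (nrm w + 1).
  by rewrite distrC; near: s; exact: Hs.
move: hc hs; rewrite !(ltr_pdivlMr _ _ w1).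
exact: aux (nrm_ge0 dot w) (normr_ge0 _) (normr_ge0 _).
Unshelve. all: by end_near.
Qed.

(** The parameters t for which the mean of length N is small form an open set.  A
finite number of lengths suffices to cover a period, and by [mean_mul] their
product then works for all parameters at once. *)
Lemma uniform_mean w (d : R) :
  (forall t, exists2 N, (0 < N)%N & nrm (mean (rot U (circ t)) N w) < d) ->
  exists2 N, (0 < N)%N & forall t, 0 <= t <= pi *+ 2 ->
    nrm (mean (rot U (circ t)) N w) < d.
Proof.
move=> H.
pose f N := interior [set s : R | nrm (mean (rot U (circ s)) N w) < d].
have cov : `[0, pi *+ 2] `<=` cover [set N | (0 < N)%N] f.
  move=> t _; have [N N0 tN] := H t; exists N => //=.
  rewrite /f /interior /=.
  pose e := (d - nrm (mean (rot U (circ t)) N w)) * N%:R.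
  have e0 : 0 < e by rewrite mulr_gt0 ?ltr0n // subr_gt0.
  have := orbit_sum_near N w t e0; apply: filterS => s /= hs.
  apply: le_lt_trans (nrm_le_add dotP _ (mean (rot U (circ t)) N w)) _.
  rewrite {1}/mean {1}/mean -scalerBr (nrmZr dotP) ?invr_ge0 ?ler0n //.
  by rewrite -ltrBrDr mulrC ltr_pdivrMr ?ltr0n.
have := @segment_compact R 0 (pi *+ 2); rewrite compact_cover.
move=> /(_ nat [set N | (0 < N)%N] f (fun i _ => open_interior _) cov)[D Dpos Dcov].
have Dpos' N : N \in D -> (0 < N)%N by move=> /Dpos /set_mem.
exists (\prod_(N <- D) N)%N => [|t t01].
  by rewrite big_seq_cond prodn_cond_gt0 // => N /andP[ND _]; exact: Dpos'.
have /Dcov[N /= ND /interior_subset/= tN] : `[0, pi *+ 2]%classic t by rewrite /= in_itv.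
rewrite (bigD1_seq N) //= ?fset_uniq // mulnC.
by apply: le_lt_trans tN; apply: mean_mul; [exact: dotP | exact/isometry_rot/isoU/unimodular_circ | exact: Dpos'].
Qed.

End Uniformity.

Section Approximation.
Context {R : realType} {V : lmodType R[i]}.
Variables (dot : V -> V -> R) (U : V -> V).
Hypothesis dotP : inner_product dot.
Hypothesis isoU : isometry dot U.
Local Notation nrm := (nrm dot).
Variable E : R[i] -> V -> V.
Hypothesis limE : forall z v, unimodular z -> mean_limit dot (rot U z) v (E z v).

(** Total boundedness of the orbit: colours are the members of a finite cover by
sets of diameter at most e. *)
Definition precompact_orbit (v : V) : Prop := forall e : R, 0 < e ->
  exists (J : finType) (c : nat -> J), forall m k, c m = c k ->
    nrm (iter m U v - iter k U v) <= e.

Theorem precompact_orbit_span v (eta : R) : precompact_orbit v -> 0 < eta ->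
  exists s : seq R[i], [/\ uniq s,
    forall z, z \in s -> unimodular z /\ 0 < nrm (E z v)
    & nrm (v - \sum_(z <- s) E z v) < eta].
Proof.
move=> tb eta0; have [J [c Hc]] := tb (eta / 2) ltac:(lra).
have J0 : (0 < #|J|)%N by apply/card_gt0P; exists (c 0%N).
have L1 : 1 <= #|J|%:R :> R by rewrite ler1n.
set L : R := #|J|%:R in L1.
(* If |w| >= eta, comparing the two estimates of the fourth moment gives
   |w|^2 <= 32 L d^2 (h5 below), that is |w|^2 <= eta^2 / (2 L) for this d. *)
pose d := eta / (8 * L).
have d0 : 0 < d by apply: divr_gt0; lra.
have d20 : 0 < d / 2 by lra.
have [s [us sH small]] := finite_spectrum dotP isoU limE v d20.
have s1 z : z \in s -> unimodular z by move=> /sH[].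
exists s; split=> // [z /sH[z1 dz]|]; first by split => //; exact: lt_le_trans dz.
rewrite ltNge; apply/negP => big_w.
set w := v - _ in big_w.
have [N N0 HN] : exists2 N, (0 < N)%N & forall t, 0 <= t <= pi *+ 2 ->
    nrm (mean (rot U (circ t)) N w) < d.
  apply: uniform_mean => // t.
  have t1 := unimodular_circ t.
  have e_small := remainder_small dotP isoU limE us s1 (ltW d20) small t1.
  have [n0 /(_ n0.+1 (leqnSn _)) Hn] := limE w t1 d20.
  exists n0.+1 => //; apply: le_lt_trans (nrm_le_add dotP _ (E (circ t) w)) _.
  by rewrite (splitr d); apply: ltr_leD.
(* The lower bound of the fourth moment uses times up to half the length of the
   exponential sums, whence the length N + N. *)
have up : forall t, 0 <= t <= pi *+ 2 -> nrm (mean (rot U (circ t)) (N + N) w) <= d.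
  move=> t t01; apply: le_trans (ltW (HN t t01)); rewrite addnn -mul2n.
  by apply: mean_mul => //; apply: isometry_rot => //; exact: unimodular_circ.
have NN0 : (0 < N + N)%N by rewrite addn_gt0 N0.
have := fourth_moment_le dotP isoU NN0 up.
have := @fourth_moment_ge R (fun m k => dot (iter m U w) (iter k U w))
  (dot_iter isoU w) N.
have := @pigeonhole_corr R (fun m k => dot (iter m U w) (iter k U w))
  (dot_iter isoU w) N J c ((nrm w ^+ 2 / 2) ^+ 2) (sqr_ge0 _).
move: (\sum_(0 <= n < N) _) => X.
move: (\sum_(0 <= m < N + N) _) => Y.
have W2 := exprn_gt0 2 (lt_le_trans eta0 big_w).
have -> : (forall m k, c m = c k -> (nrm w ^+ 2 / 2) ^+ 2 <=
    dot (iter m U w) (iter k U w) ^+ 2) <-> True.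
  split=> // _ m k /Hc mk.
  have := remainder_corr dotP isoU limE us s1 mk; rewrite -/w => H.
  rewrite ler_pXn2r ?nnegrE ?divr_ge0 // ?(ltW W2) //; last first.
    by apply: le_trans H; nra.
  by apply: le_trans H; nra.
move=> /(_ I); rewrite -/L.
set W := nrm w ^+ 2 in W2 *; set n : R := N%:R; rewrite natrD -/n.
move=> h1 h2 h3.
have n0 : 0 < n by rewrite ltr0n.
have h4 : n ^+ 2 * (n * (W / 2) ^+ 2) <= L * ((n + n) * d) ^+ 2 * ((n + n) * W).
  have : n ^+ 2 * (n * (W / 2) ^+ 2) <= n ^+ 2 * (L * X) by rewrite ler_wpM2l // sqr_ge0.
  have : L * (n * (n * X)) <= L * (((n + n) * d) ^+ 2 * ((n + n) * W)).
    by rewrite ler_wpM2l ?(le_trans h2 h3) //; lra.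
  lra.
have h5 : W <= 32 * L * d ^+ 2.
  have : 0 < n ^+ 3 * W / 4 by rewrite divr_gt0 // mulr_gt0 // exprn_gt0.
  move=> pos; rewrite -(ler_pM2l pos).
  have -> : n ^+ 3 * W / 4 * W = n ^+ 2 * (n * (W / 2) ^+ 2) by field.
  apply: le_trans h4 _; rewrite le_eqVlt; apply/orP; left; apply/eqP; by field.
have h6 : 32 * L * d ^+ 2 = eta ^+ 2 / (2 * L).
  by rewrite /d; field; rewrite gt_eqF //; lra.
have h7 : eta ^+ 2 <= W by rewrite ler_pXn2r ?nnegrE ?nrm_ge0 // ltW.
have h8 : eta ^+ 2 / (2 * L) < eta ^+ 2.
  rewrite ltr_pdivrMr; last by lra.
  by rewrite ltr_pMr ?exprn_gt0 //; lra.
by move: h5; rewrite h6; lra.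
Qed.

End Approximation.

(** * Bounded measurable functions and L2 completeness *)
Section BoundedFunctions.
Context d (X : measurableType d) (R : realType) (rho : probability X R).

Definition bounded_measurable (f : X -> R) : Prop :=
  measurable_fun setT f /\ exists B, forall x, `|f x| <= B.

Definition expect (f : X -> R) : R := \int[rho]_(x in setT) f x.

Lemma bm_cst (r : R) : bounded_measurable (fun=> r).
Proof. by split; [exact: measurable_cst | exists `|r|]. Qed.

Lemma bmD f g : bounded_measurable f -> bounded_measurable g ->
  bounded_measurable (fun x => f x + g x).
Proof.
move=> [mf [A HA]] [mg [B HB]]; split; first exact: measurable_funD.
by exists (A + B) => x; rewrite (le_trans (ler_normD _ _)) // lerD.
Qed.

Lemma bmM f g : bounded_measurable f -> bounded_measurable g ->
  bounded_measurable (fun x => f x * g x).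
Proof.
move=> [mf [A HA]] [mg [B HB]]; split; first exact: measurable_funM.
by exists (A * B) => x; rewrite normrM ler_pM.
Qed.

Lemma bmN f : bounded_measurable f -> bounded_measurable (fun x => - f x).
Proof.
move=> [mf [A HA]]; split; first exact: measurable_funN.
by exists A => x; rewrite normrN.
Qed.

Lemma bmB f g : bounded_measurable f -> bounded_measurable g ->
  bounded_measurable (fun x => f x - g x).
Proof. by move=> bf bg; apply: bmD => //; exact: bmN. Qed.

Lemma bm_norm f : bounded_measurable f -> bounded_measurable (fun x => `|f x|).
Proof.
move=> [mf [A HA]]; split; first exact: measurableT_comp.
by exists A => x; rewrite normr_id.
Qed.

Lemma bmX f : bounded_measurable f -> bounded_measurable (fun x => f x ^+ 2).
Proof. by move=> bf; exact: bmM. Qed.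

Lemma bm_integrable f : bounded_measurable f -> rho.-integrable setT (EFin \o f).
Proof.
move=> [mf [A HA]]; apply: measurable_bounded_integrable => //.
  by apply: le_lt_trans (ltry 1); exact: probability_le1.
by exists A; split; rewrite ?num_real // => y Ay x _ /=; exact: le_trans (HA x) (ltW Ay).
Qed.

Lemma expectD f g : bounded_measurable f -> bounded_measurable g ->
  expect (fun x => f x + g x) = expect f + expect g.
Proof. by move=> bf bg; rewrite /expect RintegralD //; exact: bm_integrable. Qed.

Lemma expectZ r f : bounded_measurable f -> expect (fun x => r * f x) = r * expect f.
Proof. by move=> bf; rewrite /expect RintegralZl //; exact: bm_integrable. Qed.

Lemma expect_cst r : expect (fun=> r) = r.
Proof.
rewrite /expect Rintegral_cst //; rewrite [X in fine X](_ : _ = 1%E) ?mulr1 //.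
exact: probability_setT.
Qed.

Lemma le_expect f g : bounded_measurable f -> bounded_measurable g ->
  (forall x, f x <= g x) -> expect f <= expect g.
Proof. by move=> bf bg fg; apply: le_Rintegral => //; exact: bm_integrable. Qed.

Lemma expect_ge0 f : (forall x, 0 <= f x) -> 0 <= expect f.
Proof. by move=> f0; apply: Rintegral_ge0. Qed.

Lemma EFin_expect f : bounded_measurable f ->
  ((expect f)%:E = \int[rho]_(x in setT) (f x)%:E)%E.
Proof.
by move=> bf; rewrite /expect /Rintegral fineK //; exact: integrable_fin_num (bm_integrable bf).
Qed.

Lemma limn_sup_between (u : nat -> R) (a b B : R) k : (forall n, `|u n| <= B) ->
  (forall n, (k <= n)%N -> a <= u n <= b) -> a <= limn_sup u <= b.
Proof.
move=> uB ab; rewrite limn_supE; last first.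
  by exists B; split; rewrite ?num_real // => y By n _ /=; exact: le_trans (uB n) (ltW By).
have ubs n : has_ubound [set u k | k in [set k | (n <= k)%N]].
  by exists B => _ [m _ <-]; exact: le_trans (ler_norm _) (uB m).
have supB n m : (n <= m)%N -> u m <= sups u n.
  by move=> nm; apply: (ub_le_sup (ubs n)); exists m.
apply/andP; split.
  apply: lb_le_inf; first by exists (sups u 0%N); exists 0%N.
  move=> _ [n _ <-]; apply: le_trans (supB n (maxn n k) (leq_maxl _ _)).
  by case/andP: (ab _ (leq_maxr n k)).
apply: (@le_trans _ _ (sups u k)).
  apply: ge_inf; last by exists k.
  exists (- B) => _ [n _ <-]; apply: le_trans (supB n n (leqnn _)).
  by have := uB n; rewrite ler_norml => /andP[].
apply: ge_sup; first by exists (u k); exists k => /=.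
by move=> _ [n /= kn <-]; case/andP: (ab n kn).
Qed.

(** If the increments decrease geometrically, |v_k - limsup v| is dominated pointwise
by the tail of the series of the |v_(j+1) - v_j|, even where that series
diverges.  Integrating the series term by term then controls the distance to
the limit superior without any discussion of almost everywhere convergence. *)
Lemma bounded_L2_fast (v : nat -> X -> R) (B : R) :
  (forall n, measurable_fun setT (v n)) -> (forall n x, `|v n x| <= B) ->
  (forall k, expect (fun x => (v k.+1 x - v k x) ^+ 2) <= (4 ^+ k)^-1) ->
  forall k, expect (fun x => `|v k x - limn_sup (v ^~ x)|) <= 2 / 2 ^+ k.
Proof.
move=> mv vB fast k.
have bv n : bounded_measurable (v n) by split => //; exists B.
pose g x := limn_sup (v ^~ x).
have gB x : `|g x| <= B.
  rewrite ler_norml; apply: (@limn_sup_between (v ^~ x) _ _ B 0%N) => // n _.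
  by rewrite -ler_norml.
have mg : measurable_fun setT g.
  apply: measurable_fun_limn_sup => //.
  - by move=> x _; exists B => _ [n _ <-]; exact: le_trans (ler_norm _) (vB n x).
  - move=> x _; exists (- B) => _ [n _ <-].
    by have := vB n x; rewrite ler_norml => /andP[].
have bg : bounded_measurable g by split => //; exists B.
pose D j x := `|v j.+1 x - v j x|.
have bD j : bounded_measurable (D j) by apply/bm_norm/bmB.
(* This bounds the integral of an increment by that of its square. *)
have young (t a : R) : 0 < a -> `|t| <= 2^-1 * (a * t ^+ 2 + a^-1).
  move=> a0; rewrite -(real_normK (num_real t)); move: `|t| => {}t.
  rewrite -subr_ge0 (_ : _ - _ = 2^-1 * a * (t - a^-1) ^+ 2).
    by apply: mulr_ge0 (sqr_ge0 _); lra.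
  by field; rewrite gt_eqF.
have ED j : expect (D j) <= (2 ^+ j)^-1.
  have p2 : 0 < 2 ^+ j :> R by rewrite exprn_gt0.
  apply: (@le_trans _ _ (expect (fun x => 2^-1 * (2 ^+ j * (v j.+1 x - v j x) ^+ 2 + (2 ^+ j)^-1)))).
    apply: le_expect => // [|x].
      by apply/bmM/bmD/bm_cst/bmM/bmX/bmB; [exact: bm_cst | exact: bm_cst | exact: bv | exact: bv].
    exact: young.
  have b2 : bounded_measurable (fun x => (v j.+1 x - v j x) ^+ 2) by apply/bmX/bmB.
  rewrite expectZ; last by apply/bmD/bm_cst/bmM => //; exact: bm_cst.
  rewrite expectD ?expect_cst ?expectZ //; [|by apply/bmM => //; exact: bm_cst|exact: bm_cst].
  have : 2 ^+ j * expect (fun x => (v j.+1 x - v j x) ^+ 2) <= (2 ^+ j)^-1.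
    apply: (@le_trans _ _ (2 ^+ j * (4 ^+ j)^-1)); first by rewrite ler_wpM2l ?fast // ltW.
    by rewrite (_ : 4 = 2 * 2) ?exprMn ?invfM ?mulrA ?divff ?mul1r ?gt_eqF //; lra.
  by move: (_ * expect _) (_^-1) => p q; lra.
rewrite -lee_fin EFin_expect; last exact/bm_norm/bmB.
apply: (@le_trans _ _ (\int[rho]_(x in setT) \sum_(0 <= j <oo) (D (k + j)%N x)%:E)%E).
  apply: ge0_le_integral => //.
  - by apply/measurable_EFinP; case: (bm_norm (bmB (bv k) bg)).
  - apply: (@ge0_emeasurable_sum _ _ _ setT (fun j x => (D (k + j)%N x)%:E) xpredT) => [j x _ _|j _].
      by rewrite lee_fin; exact: normr_ge0.
    by apply/measurable_EFinP; case: (bD (k + j)%N).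
  move=> x _.
  have part n : ((\sum_(0 <= j < n) D (k + j)%N x)%:E <=
                 \sum_(0 <= j <oo) (D (k + j)%N x)%:E)%E.
    rewrite -sumEFin; apply: nneseries_lim_ge => j _ _.
    by rewrite lee_fin; exact: normr_ge0.
  case E : (\sum_(0 <= j <oo) (D (k + j)%N x)%:E)%E part => [s| |] part; last 2 first.
  - by rewrite leey.
  - by have := part 0%N; rewrite big_geq // leeNy_eq.
  have tele n : `|v (k + n)%N x - v k x| <= \sum_(0 <= j < n) D (k + j)%N x.
    elim: n => [|n IH]; first by rewrite addn0 subrr normr0 big_geq.
    rewrite big_nat_recr //= addnS; apply: le_trans (lerD IH (lexx _)).
    rewrite /D [X in _ <= X]addrC -(subrKA (v (k + n)%N x)).
    exact: ler_normD.
  rewrite lee_fin distrC -/(g x).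
  have : v k x - s <= g x <= v k x + s.
    apply: (@limn_sup_between (v ^~ x) _ _ B k) => // n kn.
    have := le_trans (tele (n - k)%N) (part (n - k)%N).
    by rewrite subnKC // ler_norml; lra.
  by rewrite ler_norml; lra.
rewrite integral_nneseries //; last 2 first.
- by move=> j; apply/measurable_EFinP; case: (bD (k + j)%N).
- by move=> j x _; rewrite lee_fin; exact: normr_ge0.
apply: le_trans (epsilon_trick0 xpredT _); last by rewrite divr_ge0 // exprn_ge0.
apply: lee_nneseries => [j _ _|j _].
  by apply: integral_ge0 => x _; rewrite lee_fin; exact: normr_ge0.
rewrite -EFin_expect // lee_fin; apply: le_trans (ED _) _.
rewrite natrX exprS exprD; rewrite le_eqVlt; apply/orP; left; apply/eqP.
by field; rewrite !gt_eqF // exprn_gt0.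
Qed.

Definition L2cauchy (u : nat -> X -> R) : Prop := forall e : R, 0 < e ->
  exists n0 : nat, forall n m, (n0 <= n)%N -> (n0 <= m)%N ->
    expect (fun x => (u n x - u m x) ^+ 2) < e.

Lemma expect_sqr_tri (f g h : X -> R) : bounded_measurable f -> bounded_measurable g ->
  bounded_measurable h ->
  expect (fun x => (f x - h x) ^+ 2) <=
    2 * expect (fun x => (f x - g x) ^+ 2) + 2 * expect (fun x => (g x - h x) ^+ 2).
Proof.
move=> bf bg bh.
have b1 : bounded_measurable (fun x => (f x - g x) ^+ 2) by exact/bmX/bmB.
have b2 : bounded_measurable (fun x => (g x - h x) ^+ 2) by exact/bmX/bmB.
have c2 := bm_cst 2.
rewrite -!expectZ // -expectD; [|exact: bmM|exact: bmM].
apply: le_expect => [||x]; [exact/bmX/bmB | by apply: bmD; exact: bmM |].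
by have := sqr_ge0 (f x - g x - (g x - h x)); lra.
Qed.

(** A common bound on the functions makes the L1 control of [bounded_L2_fast] along a
subsequence an L2 control, and keeps the limit bounded. *)
Lemma bounded_L2_complete (u : nat -> X -> R) (B : R) :
  (forall n, measurable_fun setT (u n)) -> (forall n x, `|u n x| <= B) ->
  L2cauchy u ->
  exists g : X -> R, bounded_measurable g /\
    forall e : R, 0 < e -> exists n0 : nat, forall n, (n0 <= n)%N ->
      expect (fun x => (u n x - g x) ^+ 2) < e.
Proof.
move=> mu uB cau.
have bu n : bounded_measurable (u n) by split => //; exists B.
have p4 k : 0 < (4 ^+ k)^-1 :> R by rewrite invr_gt0 exprn_gt0.
have [N HN] := choice (fun k => cau _ (p4 k)).
pose M := fix M k := if k is k'.+1 then maxn (M k').+1 (N k) else N 0%N.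
have MN k : (N k <= M k)%N by case: k => //= k; exact: leq_maxr.
have MS k : (M k < M k.+1)%N by exact: leq_maxl.
have Mk k : (k <= M k)%N by elim: k => // k IH; exact: leq_ltn_trans IH (MS k).
pose v k := u (M k).
have fast k : expect (fun x => (v k.+1 x - v k x) ^+ 2) <= (4 ^+ k)^-1.
  by apply/ltW/HN; [exact: leq_trans (MN k) (ltnW (MS k)) | exact: MN].
have H := bounded_L2_fast (fun n => mu _) (fun n x => uB _ x) fast.
pose g x := limn_sup (v ^~ x).
have B0 : 0 <= B by apply: le_trans (uB 0%N point).
have gB x : `|g x| <= B.
  rewrite ler_norml; apply: (@limn_sup_between (v ^~ x) _ _ B 0%N) => [n|n _]; first exact: uB.
  by rewrite -ler_norml; exact: uB.
have mg : measurable_fun setT g.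
  apply: measurable_fun_limn_sup => [x _|x _|n]; last exact: mu.
  - by exists B => _ [n _ <-]; exact: le_trans (ler_norm _) (uB _ x).
  - exists (- B) => _ [n _ <-].
    by have := uB (M n) x; rewrite ler_norml => /andP[].
have bg : bounded_measurable g by split => //; exists B.
exists g; split => // e e0.
have e40 : 0 < e / 4 by lra.
have [n0 Hn0] := cau _ e40.
have pB : 0 < e / (16 * (B + 1)) by apply: divr_gt0 => //; lra.
have [b Hb] : exists b : nat, 2 / (e / (16 * (B + 1))) < b%:R.
  by exists (Num.bound (2 / (e / (16 * (B + 1))))); apply: archi_boundP; rewrite divr_ge0 // ltW.
pose k0 := maxn n0 b.
have kn : (n0 <= M k0)%N by apply: leq_trans (Mk k0); exact: leq_maxl.
have p2 : 0 < 2 ^+ k0 :> R by rewrite exprn_gt0.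
have kB : 2 / 2 ^+ k0 < e / (16 * (B + 1)) :> R.
  rewrite ltr_pdivrMr // mulrC -ltr_pdivrMr //; apply: lt_le_trans Hb _.
  rewrite -natrX ler_nat; apply: leq_trans (leq_maxr n0 b) (ltnW _).
  exact: ltn_expl.
exists n0 => n nn0.
apply: le_lt_trans (expect_sqr_tri (bu n) (bu (M k0)) bg) _.
have h1 := Hn0 n (M k0) nn0 kn.
have h2 : expect (fun x => (u (M k0) x - g x) ^+ 2) <= 2 * B * (2 / 2 ^+ k0).
  apply: (@le_trans _ _ (2 * B * expect (fun x => `|v k0 x - g x|))); last first.
    by rewrite ler_wpM2l ?H // mulr_ge0.
  have bvg : bounded_measurable (fun x => `|v k0 x - g x|) by exact: bm_norm (bmB (bu _) bg).
  rewrite -expectZ //.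
  apply: le_expect => [||x].
  - exact: bmX (bmB (bu _) bg).
  - exact: bmM (bm_cst _) bvg.
  rewrite -(real_normK (num_real _)) expr2 ler_wpM2r //.
  by apply: le_trans (ler_normB _ _) _; have := uB (M k0) x; have := gB x; rewrite /v; lra.
have h3 : 2 * B * (2 / 2 ^+ k0) < e / 4.
  move: kB; rewrite ltr_pdivlMr; last by lra.
  have : 0 < 2 / 2 ^+ k0 :> R by rewrite divr_gt0 // exprn_gt0.
  by nra.
by lra.
Qed.

End BoundedFunctions.

(** * The Koopman isometry on bounded functions *)
Section ComplexBounded.
Context d (X : measurableType d) (R : realType).

Definition complex_bounded (g : X -> (R[i])^o) : Prop :=
  bounded_measurable (fun x => complex.Re (g x)) /\
  bounded_measurable (fun x => complex.Im (g x)).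

Definition bounded_pred : {pred X -> (R[i])^o} := fun g => `[< complex_bounded g >].

Lemma ReD (x y : R[i]) : complex.Re (x + y) = complex.Re x + complex.Re y.
Proof. by case: x; case: y. Qed.
Lemma ImD (x y : R[i]) : complex.Im (x + y) = complex.Im x + complex.Im y.
Proof. by case: x; case: y. Qed.
Lemma ReB (x y : R[i]) : complex.Re (x - y) = complex.Re x - complex.Re y.
Proof. by case: x; case: y. Qed.
Lemma ImB (x y : R[i]) : complex.Im (x - y) = complex.Im x - complex.Im y.
Proof. by case: x; case: y. Qed.
Lemma ReM (x y : R[i]) :
  complex.Re (x * y) = complex.Re x * complex.Re y - complex.Im x * complex.Im y.
Proof. by case: x; case: y. Qed.
Lemma ImM (x y : R[i]) :
  complex.Im (x * y) = complex.Re x * complex.Im y + complex.Im x * complex.Re y.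
Proof. by case: x; case: y. Qed.

Lemma bounded_submod_closed : submod_closed bounded_pred.
Proof.
split.
  by apply/asboolP; split; exact: bm_cst.
move=> a u v /asboolP[ru iu] /asboolP[rv iv]; apply/asboolP; split.
  apply: (eq_ind _ (@bounded_measurable _ _ _) _ _ (esym _)).
    exact: bmD (bmB (bmM (bm_cst _ (complex.Re a)) ru) (bmM (bm_cst _ (complex.Im a)) iu)) rv.
  by apply/funext => x; rewrite ReD ReM.
apply: (eq_ind _ (@bounded_measurable _ _ _) _ _ (esym _)).
  exact: bmD (bmD (bmM (bm_cst _ (complex.Re a)) iu) (bmM (bm_cst _ (complex.Im a)) ru)) iv.
by apply/funext => x; rewrite ImD ImM.
Qed.

HB.instance Definition _ := GRing.isSubmodClosed.Build R[i] (X -> (R[i])^o) bounded_pred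
  bounded_submod_closed.

(** The vectors are genuine functions and not classes in L2.  Indicators and the
limits of their ergodic averages are bounded, and on bounded functions all the
integrals are finite. *)
Record bfun := BFun { bval :> X -> (R[i])^o; bvalP : bval \in bounded_pred }.
HB.instance Definition _ := [isSub for bval].
HB.instance Definition _ := [Choice of bfun by <:].
HB.instance Definition _ := [SubChoice_isSubLmodule of bfun by <:].

Lemma bfunD (u v : bfun) x : (u + v) x = u x + v x.
Proof. by []. Qed.
Lemma bfunB (u v : bfun) x : (u - v) x = u x - v x.
Proof. by []. Qed.
Lemma bfunZ z (u : bfun) x : (z *: u) x = z * u x :> R[i].
Proof. by []. Qed.

End ComplexBounded.

Section Koopman.
Context d (X : measurableType d) (R : realType) (rho : probability X R).
Variable T : X -> X.
Hypothesis mT : measurable_fun setT T.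
Hypothesis invT : invariant_measure rho T.
Local Notation V := (bfun X R).
Local Notation expect := (expect rho).

Lemma bfun_Re (g : V) : bounded_measurable (fun x => complex.Re (g x)).
Proof. by case: g => g /= /asboolP[]. Qed.

Lemma bfun_Im (g : V) : bounded_measurable (fun x => complex.Im (g x)).
Proof. by case: g => g /= /asboolP[]. Qed.

Lemma bm_comp (f : X -> R) : bounded_measurable f -> bounded_measurable (f \o T).
Proof.
move=> [mf [B HB]]; split; first exact: measurableT_comp.
by exists B => x; exact: HB.
Qed.

Lemma expect_comp (f : X -> R) : bounded_measurable f -> expect (f \o T) = expect f.
Proof.
move=> bf; rewrite /expect /Rintegral; congr fine.
transitivity (\int[pushforward rho T]_(y in setT) (f y)%:E)%E.
  rewrite integral_pushforward ?preimage_setT //.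
  - by apply/measurable_EFinP; case: bf.
  - exact: bm_integrable (bm_comp bf).
apply: eq_measure_integral => A mA _.
by rewrite /pushforward /=; exact: invT.
Qed.

Definition bdot (g h : V) : R :=
  expect (fun x => complex.Re (g x) * complex.Re (h x) + complex.Im (g x) * complex.Im (h x)).

Lemma bdot_bm (g h : V) : bounded_measurable
  (fun x => complex.Re (g x) * complex.Re (h x) + complex.Im (g x) * complex.Im (h x)).
Proof. by apply: bmD; apply: bmM; [exact: bfun_Re|exact: bfun_Re|exact: bfun_Im|exact: bfun_Im]. Qed.

Lemma bdotP : inner_product bdot.
Proof.
split.
- by move=> u v; congr Rintegral; apply/funext => x; ring.
- move=> u v w; rewrite -expectD; [|exact: bdot_bm|exact: bdot_bm].
  by congr Rintegral; apply/funext => x; rewrite bfunD ReD ImD; ring.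
- move=> a u v; rewrite -expectZ; last exact: bdot_bm.
  by congr Rintegral; apply/funext => x; rewrite bfunZ ReM ImM /=; ring.
- by move=> u v; congr Rintegral; apply/funext => x; rewrite !bfunZ !ReM !ImM /=; ring.
- by move=> u; apply: expect_ge0 => x; rewrite -!expr2 addr_ge0 // sqr_ge0.
Qed.

Lemma koopman_subproof (g : V) : (fun x => g (T x)) \in (@bounded_pred _ X R).
Proof.
by apply/asboolP; split; [exact: bm_comp (bfun_Re g) | exact: bm_comp (bfun_Im g)].
Qed.

Definition koopman (g : V) : V := BFun (koopman_subproof g).

Lemma koopmanE g x : koopman g x = g (T x). Proof. by []. Qed.

Lemma bfunP (g h : V) : (forall x, g x = h x) -> g = h.
Proof. by move=> gh; apply/val_inj/funext. Qed.

Lemma koopman_isometry : isometry bdot koopman.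
Proof.
split; [by move=> u v; exact: bfunP | by move=> z u; exact: bfunP |].
by move=> u v; rewrite /bdot -(expect_comp (bdot_bm u v)).
Qed.

Lemma bfun_sum (I : Type) (s : seq I) (F : I -> V) x :
  (\sum_(i <- s) F i) x = \sum_(i <- s) F i x.
Proof. by elim/big_rec2: _ => // i y u _ <-. Qed.

Lemma iter_koopmanE n (g : V) x : iter n koopman g x = g (iter n T x).
Proof. by elim: n x => //= n IH x; rewrite IH -iterSr. Qed.

Lemma unimodularX (z : R[i]) n : unimodular z -> unimodular (z ^+ n).
Proof.
move=> z1; elim: n => [|n]; first by rewrite /unimodular expr0 /= expr1n expr0n /= addr0.
move: z1; rewrite /unimodular (exprS z) ReM ImM.
move: (z ^+ n) => [a b] /=; case: z => [p q] /= h1 h2.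
rewrite (_ : _ + _ = (p ^+ 2 + q ^+ 2) * (a ^+ 2 + b ^+ 2)); last by ring.
by rewrite h1 h2 mulr1.
Qed.

Lemma unimodular_mul_le (z w : R[i]) (B : R) : unimodular z ->
  `|complex.Re w| <= B -> `|complex.Im w| <= B ->
  `|complex.Re (z * w)| <= 2 * B /\ `|complex.Im (z * w)| <= 2 * B.
Proof.
move=> z1 rw iw.
have le1 (a b : R) : a ^+ 2 + b ^+ 2 = 1 -> `|a| <= 1.
  move=> ab; rewrite -(ler_pXn2r (ltn0Sn 1)) ?nnegrE // expr1n real_normK ?num_real //.
  by have := sqr_ge0 b; lra.
have r1 := le1 _ _ z1; have i1 : `|complex.Im z| <= 1.
  by apply: (le1 _ (complex.Re z)); rewrite addrC.
have mul1 (a b : R) : `|a| <= 1 -> `|b| <= B -> `|a * b| <= B.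
  by move=> a1 bB; rewrite normrM -[B]mul1r ler_pM.
split; [rewrite ReM; apply: le_trans (ler_normB _ _) _
       |rewrite ImM; apply: le_trans (ler_normD _ _) _];
  by rewrite mulrDl !mul1r lerD // mul1.
Qed.

(** The bound, uniform in N, that [bounded_L2_complete] asks for; the factor 2 comes
from bounding real and imaginary parts separately. *)
Lemma bfun_mean_bounded z (v : V) (B : R) : unimodular z ->
  (forall x, `|complex.Re (v x)| <= B) -> (forall x, `|complex.Im (v x)| <= B) ->
  forall N x, `|complex.Re (mean (rot koopman z) N v x)| <= 2 * B /\
              `|complex.Im (mean (rot koopman z) N v x)| <= 2 * B.
Proof.
move=> z1 rB iB N x.
have B0 : 0 <= B by apply: le_trans (rB x).
have [->|N0] := posnP N.
  by rewrite /mean big_geq // scaler0 /= normr0 !mulr_ge0.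
rewrite /mean bfunZ ReM ImM /= !mul0r subr0 addr0 bfun_sum.
have bnd (f : R[i] -> R) : {morph f : a b / a + b} -> f 0 = 0 ->
    (forall n, `|f (z ^+ n * v (iter n T x))| <= 2 * B) ->
    `|N%:R^-1 * f (\sum_(0 <= n < N) iter n (rot koopman z) v x)| <= 2 * B.
  move=> fD f0 fB; rewrite (big_morph f fD f0) normrM ger0_norm ?invr_ge0 ?ler0n //.
  rewrite mulrC ler_pdivrMr ?ltr0n //; apply: le_trans (ler_norm_sum _ _ _) _.
  rewrite mulr_natr -[X in _ *+ X]subn0 -sumr_const_nat; apply: ler_sum => n _.
  by rewrite (iter_rot koopman_isometry) bfunZ iter_koopmanE.
split; apply: bnd => // [a b|n].
- exact: ReD.
- exact: (unimodular_mul_le (unimodularX n z1) (rB _) (iB _)).1.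
- exact: ImD.
- exact: (unimodular_mul_le (unimodularX n z1) (rB _) (iB _)).2.
Qed.

Lemma bdotE (g : V) : bdot g g = expect (fun x => complex.Re (g x) ^+ 2) +
  expect (fun x => complex.Im (g x) ^+ 2).
Proof.
by rewrite /bdot expectD //; [exact: bmX (bfun_Re g)|exact: bmX (bfun_Im g)].
Qed.

Lemma bfun_mean_limit z (v : V) : unimodular z ->
  exists e, mean_limit bdot (rot koopman z) v e.
Proof.
move=> z1.
have [_ [B1 HB1]] := bfun_Re v; have [_ [B2 HB2]] := bfun_Im v.
pose B := Num.max B1 B2.
have rB x : `|complex.Re (v x)| <= B by rewrite le_max HB1.
have iB x : `|complex.Im (v x)| <= B by rewrite le_max HB2 orbT.
have bnd := bfun_mean_bounded z1 rB iB.
have iso := isometry_rot bdotP z1 koopman_isometry.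
pose A N := mean (rot koopman z) N v.
have cau (f : R[i] -> R) : (forall N M, expect (fun x => (f (A N x) - f (A M x)) ^+ 2) <=
    nrm bdot (A N - A M) ^+ 2) -> L2cauchy rho (fun N x => f (A N x)).
  move=> Hf e e0; have se : 0 < Num.sqrt e by rewrite sqrtr_gt0.
  have [n0 Hn0] := mean_cauchy bdotP iso v se.
  exists n0 => n m nn mn; apply: le_lt_trans (Hf n m) _.
  rewrite -[X in _ < X](sqr_sqrtr (ltW e0)) ltr_pXn2r ?nnegrE ?nrm_ge0 ?sqrtr_ge0 //.
  exact: Hn0.
have cr : L2cauchy rho (fun N x => complex.Re (A N x)).
  apply: cau => N M; rewrite (nrm_sqr bdotP) bdotE.
  rewrite (_ : expect _ = expect (fun x => complex.Re ((A N - A M) x) ^+ 2)); last first.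
    by congr Rintegral; apply/funext => x; rewrite bfunB (ReB, ImB).
  by rewrite lerDl; apply: expect_ge0 => x; exact: sqr_ge0.
have ci : L2cauchy rho (fun N x => complex.Im (A N x)).
  apply: cau => N M; rewrite (nrm_sqr bdotP) bdotE.
  rewrite (_ : expect _ = expect (fun x => complex.Im ((A N - A M) x) ^+ 2)); last first.
    by congr Rintegral; apply/funext => x; rewrite bfunB (ReB, ImB).
  by rewrite lerDr; apply: expect_ge0 => x; exact: sqr_ge0.
have [g1 [bg1 H1]] := bounded_L2_complete (fun N => (bfun_Re (A N)).1)
  (fun N x => (bnd N x).1) cr.
have [g2 [bg2 H2]] := bounded_L2_complete (fun N => (bfun_Im (A N)).1)
  (fun N x => (bnd N x).2) ci.
have eP : (fun x => (g1 x +i* g2 x)%C) \in (@bounded_pred _ X R).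
  by apply/asboolP; split.
exists (BFun eP) => eps eps0.
have ep : 0 < eps ^+ 2 / 2 by rewrite divr_gt0 // exprn_gt0.
have [n1 Hn1] := H1 _ ep; have [n2 Hn2] := H2 _ ep.
exists (maxn n1 n2) => N; rewrite geq_max => /andP[N1 N2].
rewrite -(ltr_pXn2r (ltn0Sn 1)) ?nnegrE ?nrm_ge0 ?(ltW eps0) //.
rewrite (nrm_sqr bdotP) bdotE -/(A N) [X in _ < X]splitr; apply: ltrD.
- rewrite (_ : expect _ = expect (fun x => (complex.Re (A N x) - g1 x) ^+ 2)); first exact: Hn1.
  by congr Rintegral; apply/funext => x; rewrite bfunB (ReB, ImB).
- rewrite (_ : expect _ = expect (fun x => (complex.Im (A N x) - g2 x) ^+ 2)); first exact: Hn2.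
  by congr Rintegral; apply/funext => x; rewrite bfunB (ReB, ImB).
Qed.

End Koopman.

(** * Sets with precompact orbit *)
Section DecreasingSets.
Context d (X : measurableType d) (R : realType) (rho : probability X R).

Lemma rho_decreasing_small (F : nat -> set X) (e : R) : 0 < e ->
  (forall n, measurable (F n)) -> (forall n m, (n <= m)%N -> F m `<=` F n) ->
  (forall x, exists n, ~ F n x) -> exists n, (rho (F n) <= e%:E)%E.
Proof.
move=> e0 mF decF F0.
have cv : (fun n => rho (F n)) @ \oo --> 0%E.
  have -> : 0%E = rho (\bigcap_n (F n)).
    rewrite (_ : \bigcap_n _ = set0) ?measure0 //; apply/seteqP; split => // x Hx.
    by have [n] := F0 x; apply; exact: Hx.
  apply: nonincreasing_cvg_mu => //.
  - by apply: le_lt_trans (ltry 1); exact: probability_le1.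
  - by apply: bigcapT_measurable.
  - by move=> n m nm; apply/subsetPset; exact: decF.
have /fine_cvgP[fin /cvgrPdist_lt/(_ _ e0) cv'] := cv.
near \oo => n; exists n.
have : `|0 - fine (rho (F n))| < e by near: n; exact: cv'.
rewrite sub0r normrN ger0_norm ?fine_ge0 // => h.
rewrite -[X in (X <= _)%E]fineK ?lee_fin ?ltW //.
by near: n; exact: fin.
Unshelve. all: by end_near.
Qed.

End DecreasingSets.

Section PrecompactSets.
Context d (X : measurableType d) (R : realType) (rho : probability X R).
Variable T : X -> X.
Hypothesis mT : measurable_fun setT T.
Hypothesis invT : invariant_measure rho T.

(** Total boundedness of the family of preimages of A for the pseudometric given by
the measure of the symmetric difference.  One of the two differences is enough
since the condition is symmetric in m and k. *)
Definition precompact_set (A : set X) : Prop := measurable A /\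
  forall e : R, 0 < e -> exists (J : finType) (c : nat -> J), forall m k, c m = c k ->
    (rho ((iter m T @^-1` A) `\` (iter k T @^-1` A)) <= e%:E)%E.

Lemma measurable_iter m : measurable_fun setT (iter m T).
Proof. by elim: m => [|m IH]; [exact: measurable_id | exact: measurableT_comp]. Qed.

Lemma measurable_preimage m (A : set X) : measurable A -> measurable (iter m T @^-1` A).
Proof. by move=> mA; rewrite -[_ @^-1` _]setTI; exact: measurable_iter. Qed.

Lemma rho_preimage m (A : set X) : measurable A -> rho (iter m T @^-1` A) = rho A.
Proof.
move=> mA; elim: m => // m IH.
by rewrite -[RHS]IH -(invT (measurable_preimage m mA)); congr (rho _); apply/seteqP; split => x /=; rewrite -iterSr.
Qed.

Lemma precompact_setC A : precompact_set A -> precompact_set (~` A).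
Proof.
move=> [mA H]; split; first exact: measurableC.
move=> e /H[J [c Hc]]; exists J, c => m k mk.
apply: le_trans (Hc k m (esym mk)); rewrite le_eqVlt; apply/orP; left; apply/eqP.
congr (rho _); apply/seteqP; split => x /= [h1 h2]; split => //.
exact: contrapT.
Qed.

Lemma precompact_set0 : precompact_set set0.
Proof.
split => // e e0; exists unit, (fun=> tt) => m k _.
by rewrite preimage_set0 set0D measure0 lee_fin ltW.
Qed.

Lemma precompact_setU A B : precompact_set A -> precompact_set B -> precompact_set (A `|` B).
Proof.
move=> [mA HA] [mB HB]; split; first exact: measurableU.
move=> e e0; have e2 : 0 < e / 2 by lra.
have [J1 [c1 H1]] := HA _ e2; have [J2 [c2 H2]] := HB _ e2.
exists (J1 * J2)%type, (fun n => (c1 n, c2 n)) => m k [mk1 mk2].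
rewrite [e]splitr EFinD; apply: le_trans (leeD (H1 m k mk1) (H2 m k mk2)).
have mD (C : set X) : measurable C ->
    measurable ((iter m T @^-1` C) `\` (iter k T @^-1` C)).
  by move=> mC; apply: measurableD; exact: measurable_preimage.
apply: le_trans (measureU2 _ (mD A mA) (mD B mB)).
apply: le_measure; rewrite ?inE.
- by apply: mD; exact: measurableU.
- by apply: measurableU; exact: mD.
- by move=> x /= [[h|h] /not_orP[n1 n2]]; [left|right].
Qed.

(** Invariance of rho makes the error of an inner approximation uniform along the
orbit. *)
Lemma precompact_set_approx A : measurable A ->
  (forall e : R, 0 < e -> exists B, [/\ precompact_set B, B `<=` A & (rho (A `\` B) <= e%:E)%E]) ->
  precompact_set A.
Proof.
move=> mA H; split => // e e0; have e2 : 0 < e / 2 by lra.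
have [B [[mB HB] BA AB]] := H _ e2.
have [J [c Hc]] := HB _ e2; exists J, c => m k mk.
have mAB : measurable (A `\` B) by exact: measurableD.
rewrite [e]splitr EFinD.
have h1 : (rho (iter m T @^-1` (A `\` B)) <= (e / 2)%:E)%E by rewrite rho_preimage.
apply: le_trans (leeD h1 (Hc m k mk)).
have m1 := measurable_preimage m mAB.
have m2 : measurable ((iter m T @^-1` B) `\` (iter k T @^-1` B)).
  by apply: measurableD; exact: measurable_preimage.
apply: le_trans (measureU2 _ m1 m2).
apply: le_measure; rewrite ?inE.
- by apply: measurableD; exact: measurable_preimage.
- exact: measurableU.
- move=> x /= [Am Ak]; have [Bm|Bm] := pselect (B (iter m T x)); last by left.
  by right; split => // /BA.
Qed.

Lemma precompact_bigcup (F : nat -> set X) : (forall n, precompact_set (F n)) ->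
  precompact_set (\bigcup_n F n).
Proof.
move=> HF.
pose G n := \big[setU/set0]_(i < n) F i.
have HG n : precompact_set (G n).
  rewrite /G; elim: n => [|n IH]; first by rewrite big_ord0; exact: precompact_set0.
  by rewrite big_ord_recr; exact: precompact_setU.
have mF : measurable (\bigcup_n F n) by apply: bigcup_measurable => n _; case: (HF n).
apply: precompact_set_approx => // e e0.
have [n Hn] : exists n, (rho ((\bigcup_n F n) `\` G n) <= e%:E)%E.
  apply: rho_decreasing_small => // [n|n m nm x [Fx Gx]|x].
  - by apply: measurableD => //; case: (HG n).
  - split => // Gnx; apply: Gx; move: Gnx.
    rewrite /G -!bigcup_mkord => -[i /= ilt Fi]; exists i => //=.
    exact: leq_trans nm.
  - have [[i _ Fi]|nF] := pselect ((\bigcup_n F n) x); last by exists 0%N => -[].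
    by exists i.+1 => -[_]; apply; rewrite /G -bigcup_mkord; exists i => /=.
exists (G n); split => //.
by rewrite /G -bigcup_mkord => x [i _ Fi]; exists i.
Qed.

Lemma precompact_sigma_algebra : sigma_algebra setT precompact_set.
Proof.
split; [exact: precompact_set0 | | exact: precompact_bigcup].
by move=> A /precompact_setC; rewrite setTD.
Qed.

Local Notation V := (bfun X R).
Local Notation nrm := (nrm (bdot rho)).
Local Notation U := (koopman mT).
Local Notation tb := (precompact_orbit (bdot rho) U).

Lemma precompact_orbitD (u v : V) : tb u -> tb v -> tb (u + v).
Proof.
move=> Hu Hv e e0; have e2 : 0 < e / 2 by lra.
have [J1 [c1 H1]] := Hu _ e2; have [J2 [c2 H2]] := Hv _ e2.
exists (J1 * J2)%type, (fun n => (c1 n, c2 n)) => m k [mk1 mk2].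
rewrite !(iter_isoD (koopman_isometry mT invT)) opprD addrACA [e]splitr.
exact: le_trans (nrmD (bdotP rho) _ _) (lerD (H1 m k mk1) (H2 m k mk2)).
Qed.

Lemma precompact_orbitZ z (u : V) : tb u -> tb (z *: u).
Proof.
move=> Hu e e0; pose C : R := `|complex.Re z| + `|complex.Im z| + 1.
have C0 : 0 < C by rewrite ltr_wpDl // addr_ge0.
have [J [c H]] := Hu _ (divr_gt0 e0 C0); exists J, c => m k mk.
rewrite !(isoZ (isometry_iter _ (koopman_isometry mT invT))) -scalerBr.
apply: le_trans (nrm_scale_le (bdotP rho) _ _) _.
have := H m k mk; rewrite ler_pdivlMr // => h; apply: le_trans h.
by rewrite mulrC ler_wpM2l ?nrm_ge0 // lerDl.
Qed.

Lemma precompact_orbit_sum (I : Type) (s : seq I) (F : I -> V) :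
  (forall i, tb (F i)) -> tb (\sum_(i <- s) F i).
Proof.
move=> HF; elim/big_rec: _ => [|i u _]; last exact: precompact_orbitD.
by rewrite -(scale0r 0); apply: precompact_orbitZ => e e0; exists unit, (fun=> tt) => m k _;
  rewrite !(iso0 (isometry_iter _ (koopman_isometry mT invT))) subrr (nrm0 (bdotP rho)) ltW.
Qed.

Lemma bm_indic (A : set X) : measurable A -> bounded_measurable (\1_A : X -> R).
Proof.
move=> mA; split; first exact: measurable_indic.
by exists 1 => x; rewrite indicE; case: (x \in A); rewrite ?normr1 ?normr0.
Qed.

Lemma indic_subproof (A : set X) : measurable A ->
  (fun x => (\1_A x : R)%:C%C) \in (@bounded_pred _ X R).
Proof. by move=> mA; apply/asboolP; split; [exact: bm_indic | exact: bm_cst]. Qed.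

Definition bindic (A : set X) (mA : measurable A) : V := BFun (indic_subproof mA).

Lemma expect_indic (A : set X) : measurable A -> (expect rho \1_A)%:E = rho A.
Proof.
move=> mA; rewrite EFin_expect; last exact: (bm_indic mA).
by rewrite integral_indic ?setIT.
Qed.

Lemma precompact_bindic (A : set X) (mA : measurable A) : precompact_set A -> tb (bindic mA).
Proof.
move=> [_ HA] e e0; have e2 : 0 < e ^+ 2 / 2 by rewrite divr_gt0 // exprn_gt0.
have [J [c Hc]] := HA _ e2; exists J, c => m k mk.
rewrite -(ler_pXn2r (ltn0Sn 1)) ?nnegrE ?nrm_ge0 ?(ltW e0) // (nrm_sqr (bdotP rho)).
pose D m k := (iter m T @^-1` A) `\` (iter k T @^-1` A).
have mD i j : measurable (D i j) by apply: measurableD; exact: measurable_preimage.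
have Dle i j : c i = c j -> expect rho \1_(D i j) <= e ^+ 2 / 2.
  by move=> /Hc; rewrite -lee_fin expect_indic.
rewrite (_ : bdot _ _ _ = expect rho \1_(D m k) + expect rho \1_(D k m)).
  by rewrite [X in _ <= X]splitr lerD // Dle.
rewrite bdotE -(expectD rho (bm_indic (mD m k)) (bm_indic (mD k m))).
rewrite [X in _ + X](_ : _ = 0) ?addr0; last first.
  rewrite -(@expect_cst _ _ _ rho 0); congr Rintegral; apply/funext => x.
  by rewrite bfunB ImB !iter_koopmanE /= subrr expr0n.
congr Rintegral; apply/funext => x.
rewrite bfunB ReB !iter_koopmanE /= !indicE !in_setD.
have E j : (x \in iter j T @^-1` A) = (iter j T x \in A) by apply/idP/idP; rewrite !inE.
rewrite !E; case: (iter m T x \in A); case: (iter k T x \in A) => /=; ring.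
Qed.

End PrecompactSets.

Lemma truncn_close (R : realType) (a b : R) : 0 <= a -> 0 <= b ->
  Num.truncn a = Num.truncn b -> `|a - b| <= 1.
Proof.
move=> a0 b0 ab; have := truncn_itv a0; have := truncn_itv b0; rewrite ab -natr1.
by move=> /andP[h1 h2] /andP[h3 h4]; rewrite ler_norml; apply/andP; split; lra.
Qed.

Section PrecompactBalls.
Context d (X : measurableType d) (R : realType) (rho : probability X R).
Variable T : X -> X.
Hypothesis mT : measurable_fun setT T.
Hypothesis invT : invariant_measure rho T.
Variables (dist : X -> X -> R) (Bd : R) (q : nat -> X).
Hypothesis dist_lip : forall x y z, `|dist x z - dist y z| <= dist x y.
Hypothesis dist_contr : forall x y, dist (T x) (T y) <= dist x y.
Hypothesis dist_bounded : forall x y, 0 <= dist x y <= Bd.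
Hypothesis ball_measurable : forall x r, measurable [set y | dist y x <= r].
Hypothesis dense : forall x (e : R), 0 < e -> exists k, dist x (q k) <= e.

Lemma dist_iter n x y : dist (iter n T x) (iter n T y) <= dist x y.
Proof. by elim: n => //= n IH; exact: le_trans (dist_contr _ _) IH. Qed.

(** Finitely many small balls around the points q i, i < p, cover X up to measure
e / 2, and the colour of n records the distances from T^n (q i) to x0 up to a
small error.  Two times m and k of the same colour give nearly equal distances
from T^m y and T^k y to x0 for all y in the cover; so T^m y can be in the ball
while T^k y is not only if T^k y lies in a thin shell around the ball, and the
measure of that event is by invariance that of the shell. *)
Lemma precompact_ball x0 (r : R) : precompact_set rho T [set y | dist y x0 <= r].
Proof.
split => // e e0; have e2 : 0 < e / 2 by lra.
pose S n : set X := [set y | dist y x0 <= r + n.+1%:R^-1] `\` [set y | dist y x0 <= r].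
have [N HN] : exists n, (rho (S n) <= (e / 2)%:E)%E.
  apply: rho_decreasing_small => // [n|n m nm x [/= h1 h2]|x].
  - exact: measurableD.
  - split=> //=; apply: le_trans h1 _; rewrite lerD2l lef_pV2 ?posrE ?ltr0n // ler_nat //.
  - have [xr|xr] := leP (dist x x0) r; first by exists 0%N => -[].
    have dr : 0 < dist x x0 - r by rewrite subr_gt0.
    have h0 : 0 <= (dist x x0 - r)^-1 by rewrite invr_ge0 ltW.
    exists (Num.bound (dist x x0 - r)^-1) => -[/= h _].
    have := archi_boundP h0; rewrite ltNge => /negP; apply.
    move: h; rewrite addrC -lerBlDr => h.
    have h3 : (dist x x0 - r)^-1 >= (Num.bound (dist x x0 - r)^-1).+1%:R.
      by rewrite -[X in X <= _]invrK lef_pV2 ?posrE ?invr_gt0 ?ltr0n.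
    by apply: le_trans h3; rewrite ler_nat.
(* One third of the width of the shell, for each of the two moves from y to a
   centre and for the rounding of the distances. *)
pose eta : R := N.+1%:R^-1 / 3.
have eta0 : 0 < eta by rewrite divr_gt0 // invr_gt0 ltr0n.
pose B k : set X := [set y | dist y (q k) <= eta].
have [p Hp] : exists p, (rho (~` \big[setU/set0]_(i < p) B i) <= (e / 2)%:E)%E.
  apply: rho_decreasing_small => // [n|n m nm x|x].
  - by apply: measurableC; apply: bigsetU_measurable => i _; exact: ball_measurable.
  - rewrite -!bigcup_mkord /= => h [i /= ilt Bi]; apply: h; exists i => //=.
    exact: leq_trans nm.
  - have [k Hk] := dense x eta0; exists k.+1; rewrite -bigcup_mkord /= => h; apply: h.
    by exists k => /=.
pose G := \big[setU/set0]_(i < p) B i; rewrite -/G in Hp.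
pose L := Num.truncn (Bd / eta).
pose cc n i : nat := Num.truncn (dist (iter n T (q i)) x0 / eta).
have ccL n i : (cc n i < L.+1)%N.
  rewrite ltnS; apply: le_truncn; rewrite ler_pM2r ?invr_gt0 //.
  by case/andP: (dist_bounded (iter n T (q i)) x0).
exists {ffun 'I_p -> 'I_L.+1}, (fun n => [ffun i : 'I_p => Ordinal (ccL n i)]) => m k.
move=> /ffunP mk.
have close (i : 'I_p) : `|dist (iter m T (q i)) x0 - dist (iter k T (q i)) x0| <= eta.
  have := mk i; rewrite !ffunE => /(congr1 val) /=; rewrite /cc => h.
  have d0 n : 0 <= dist (iter n T (q i)) x0 / eta.
    by apply: divr_ge0 (ltW eta0); case/andP: (dist_bounded (iter n T (q i)) x0).
  have := truncn_close (d0 m) (d0 k) h.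
  by rewrite -mulrBl normrM (gtr0_norm (x := eta^-1)) ?invr_gt0 // ler_pdivrMr // mul1r.
rewrite [e]splitr EFinD.
have h1 : (rho (iter k T @^-1` (S N)) <= (e / 2)%:E)%E.
  by rewrite (rho_preimage mT invT) //; exact: measurableD.
apply: le_trans (leeD Hp h1).
have mG : measurable (~` G).
  by apply: measurableC; apply: bigsetU_measurable => i _; exact: ball_measurable.
have mS : measurable (iter k T @^-1` (S N)) by apply: measurable_preimage => //; exact: measurableD.
apply: le_trans (measureU2 _ mG mS).
apply: le_measure; rewrite ?inE.
- by apply: measurableD; exact: measurable_preimage.
- exact: measurableU.
move=> y /= [ym yk]; have [Gy|] := pselect (G y); last by left.
right; split => //=; move: Gy; rewrite /G -bigcup_mkord => -[i /= ip Bi].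
have := close (Ordinal ip) => /= ci.
have a1 := le_trans (dist_lip (iter m T y) (iter m T (q i)) x0) (le_trans (dist_iter m _ _) Bi).
have a2 := le_trans (dist_lip (iter k T y) (iter k T (q i)) x0) (le_trans (dist_iter k _ _) Bi).
have -> : N.+1%:R^-1 = 3 * eta :> R by rewrite /eta mulrC divfK.
move: ci a1 a2; rewrite !ler_norml => /andP[c1 c2] /andP[b1 b2] /andP[d1 d2].
lra.
Qed.

End PrecompactBalls.

(** * The space X_f with the sup distance *)
Section Modulus.
Context {R : realType}.
Implicit Types z w : R[i].

Lemma cmodE z : `|z| = (cmod z)%:C%C.
Proof. by []. Qed.

Lemma cmod_ge0 z : 0 <= cmod z.
Proof. by rewrite -lecR -cmodE normr_ge0. Qed.

Lemma cmodD z w : cmod (z + w) <= cmod z + cmod w.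
Proof. by rewrite -lecR rmorphD /= -!cmodE ler_normD. Qed.

Lemma cmodN z : cmod (- z) = cmod z.
Proof. by apply/eqP; rewrite eq_le -!lecR -!cmodE normrN lexx. Qed.

Lemma cmodB z w : cmod (z - w) <= cmod z + cmod w.
Proof. by rewrite -(cmodN w) cmodD. Qed.

Lemma cmodBC z w : cmod (z - w) = cmod (w - z).
Proof. by rewrite -cmodN opprB. Qed.

Lemma cmodB_tri y z w : cmod (z - w) <= cmod (z - y) + cmod (y - w).
Proof. by have := cmodD (z - y) (y - w); rewrite addrA subrK. Qed.

Lemma posC_real (e : R[i]) : 0 < e -> exists2 r : R, 0 < r & e = r%:C%C.
Proof.
case: e => a b; rewrite ltcE /= => /andP[/eqP b0 a0].
by exists a => //; move: b0 => /= ->.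
Qed.

Lemma cvg_cmod (I : Type) (F : set_system I) (FF : Filter F) (g : I -> R[i]) (y : R[i]) :
  g @ F --> y -> forall e : R, 0 < e -> \forall t \near F, cmod (y - g t) < e.
Proof.
move=> gy e e0; have eC : 0 < e%:C%C :> R[i] by rewrite ltcR.
have := (@cvgrPdist_lt R[i] (R[i])^o I F FF g y).1 gy _ eC.
by apply: filterS => t; rewrite cmodE ltcR.
Qed.

End Modulus.

Section SequenceSpace.
Context {R : realType}.
Variable f : int -> R[i].
Hypothesis hf : KZ f.
Local Notation X := (Xspace f).

Definition coord (x : X) (n : int) : R[i] := set_val x n.

Definition seqdist (x y : X) : R := linf_norm (fun n => coord x n - coord y n).

Lemma coord_bounded : exists2 C : R, 0 <= C & forall x n, cmod (coord x n) <= C.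
Proof.
have [[C HC] _] := hf.
have fC n : cmod (f n) <= C by apply: HC; exists n.
have C0 : 0 <= C := le_trans (cmod_ge0 _) (fC 0).
exists C => // x n; rewrite /coord set_valE.
have [s Hs] := set_valP x.
apply/ler_addgt0Pr => e e0.
have [k _ Hk] := cvg_cmod _ (Hs n) e0.
have := Hk k (leqnn k) => /= h.
have := cmodD (\val x n - translate (s k) f n) (translate (s k) f n).
rewrite subrK; have := fC (n + s k); rewrite /translate in h *.
lra.
Qed.

Lemma seqdist_has_sup x y : has_sup (range (fun n => cmod (coord x n - coord y n))).
Proof.
have [C C0 HC] := coord_bounded; split; first by exists (cmod (coord x 0 - coord y 0)); exists 0.
exists (C + C) => _ [n _ <-]; apply: le_trans (cmodB _ _) _.
exact: lerD.
Qed.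

Lemma seqdistP x y (r : R) : (seqdist x y <= r) <-> forall n, cmod (coord x n - coord y n) <= r.
Proof.
have [ne ub] := seqdist_has_sup x y; split => [h n|h].
  by apply: le_trans h; apply: (ub_le_sup ub); exists n.
by apply: ge_sup => // _ [n _ <-].
Qed.

Lemma seqdist_coord x y n : cmod (coord x n - coord y n) <= seqdist x y.
Proof. exact: (seqdistP x y _).1. Qed.

Lemma seqdistC x y : seqdist x y = seqdist y x.
Proof.
apply/le_anti/andP; split; apply/seqdistP => n; rewrite cmodBC; exact: seqdist_coord.
Qed.

Lemma seqdist_tri y x z : seqdist x z <= seqdist x y + seqdist y z.
Proof.
apply/seqdistP => n; apply: le_trans (cmodB_tri (coord y n) _ _) _.
by rewrite lerD // seqdist_coord.
Qed.

Lemma seqdist_lip x y z : `|seqdist x z - seqdist y z| <= seqdist x y.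
Proof.
rewrite ler_norml; have := seqdist_tri y x z; have := seqdist_tri x y z.
by rewrite (seqdistC y x) => h1 h2; apply/andP; split; lra.
Qed.

Lemma seqdist_bounded : exists B : R, forall x y, 0 <= seqdist x y <= B.
Proof.
have [C C0 HC] := coord_bounded; exists (C + C) => x y; apply/andP; split.
  exact: le_trans (cmod_ge0 _) (seqdist_coord x y 0).
by apply/seqdistP => n; apply: le_trans (cmodB _ _) (lerD _ _).
Qed.

Lemma coord_shift x n : coord (Xshift x) n = coord x (n + 1).
Proof. by rewrite /coord !set_valE. Qed.

Lemma seqdist_shift x y : seqdist (Xshift x) (Xshift y) <= seqdist x y.
Proof. by apply/seqdistP => n; rewrite !coord_shift; exact: seqdist_coord. Qed.

Lemma seqdist_dense : exists q : nat -> X, forall x (e : R), 0 < e ->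
  exists k, seqdist x (q k) <= e.
Proof.
have [_ [D [/countable_injP[g ginj] DX Ddense]]] := hf.
have : forall k, exists x : X, (exists2 y, D y & g y = k) -> D (\val x) /\ g (\val x) = k.
  move=> k; have [[y Dy gy]|no] := pselect (exists2 y, D y & g y = k).
    by exists (SigSub (mem_set (DX y Dy))).
  by exists point => h; case: no.
move=> /choice[q Hq]; exists q => x e e0.
have [y Dy xy] := Ddense _ (set_valP x) e e0.
exists (g y); have [Dq gq] := Hq (g y) (ex_intro2 _ _ y Dy erefl).
have yq : \val (q (g y)) = y by apply: ginj; rewrite ?inE.
apply/seqdistP => n; apply: ltW; apply: le_lt_trans xy.
apply: ub_le_sup; last by exists n => //; rewrite /coord !set_valE yq.
have [_ [B HB]] := seqdist_has_sup x (q (g y)).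
exists B => _ [m _ <-]; apply: HB; exists m => //.
by rewrite /coord !set_valE yq.
Qed.

Lemma coord_continuous n : continuous (fun x : X => coord x n).
Proof.
move=> x; apply: (@continuous_comp X {ptws int -> R[i]} R[i] set_val (@proj int (fun=> R[i]) n)).
  exact: initial_continuous.
exact: proj_continuous.
Qed.

(** Uniform convergence implies pointwise convergence. *)
Lemma open_seqball (W : set X) x : open W -> W x ->
  exists2 e : R, 0 < e & forall y, seqdist x y < e -> W y.
Proof.
move=> [W' oW' <-] /= W'x.
have nW : nbhs (set_val x : {ptws int -> R[i]}) W' by apply: open_nbhs_nbhs.
have /uniform_nbhs[E [entE HE]] : nbhs (set_val x : {uniform int -> R[i]}) W'.
  apply: (@pointwise_uniform_cvg int R[i] (set_val x) (nbhs (set_val x : {uniform int -> R[i]}))).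
  - exact: cvg_id.
  - exact: nW.
move: entE; rewrite -entourage_from_ballE => -[e /= e0 eE].
have [r r0 er] := posC_real e0; exists r => // y xy; apply: HE => n _; apply: eE => /=.
suff : `|coord x n - coord y n| < e by [].
rewrite er cmodE ltcR; exact: le_lt_trans (seqdist_coord x y n) xy.
Qed.

Lemma coord_ball_measurable n (c : R[i]) (r : R) :
  measurable ([set y | cmod (coord y n - c) <= r] : set (borel X)).
Proof.
rewrite -[X in measurable X]setCK; apply: measurableC; apply: sub_sigma_algebra.
rewrite /= openE => y /= /negP; rewrite -ltNge => yr.
have d0 : 0 < cmod (coord y n - c) - r by rewrite subr_gt0.
have := cvg_cmod (nbhs_filter y) (@coord_continuous n y) d0.
rewrite /interior /=; apply: filterS => z /= yz; apply/negP; rewrite -ltNge.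
by have := cmodB_tri (coord z n) (coord y n) c; lra.
Qed.

Lemma bigcap_coord_measurable (P : int -> set X) :
  (forall n, measurable (P n : set (borel X))) ->
  measurable ([set y | forall n, P n y] : set (borel X)).
Proof.
move=> mP; rewrite (_ : [set y | _] = \bigcap_k P (odflt 0 (choice.unpickle k))).
  by apply: bigcapT_measurable => k; exact: mP.
apply/seteqP; split => y /=; first by move=> h k _; exact: h.
by move=> h n; have := h (choice.pickle n) I; rewrite choice.pickleK.
Qed.

(** A closed ball for the sup distance is defined by countably many conditions, one
for each coordinate. *)
Lemma closed_seqball_measurable x (r : R) :
  measurable ([set y | seqdist y x <= r] : set (borel X)).
Proof.
rewrite (_ : [set y | _] = [set y | forall n, [set y | cmod (coord y n - coord x n) <= r] y]).
  by apply: bigcap_coord_measurable => n; exact: coord_ball_measurable.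
by apply/seteqP; split => y /= /seqdistP.
Qed.

(** This is where separability enters: the sup distance has far more open sets than
pointwise convergence, but countably many of its balls generate the Borel sets
of the latter. *)
Lemma open_bigcup_seqball (q : nat -> X) (W : set X) :
  (forall x (e : R), 0 < e -> exists k, seqdist x (q k) <= e) -> open W ->
  exists S : nat -> nat -> bool, W =
    \bigcup_i \bigcup_j (if S i j then [set y | seqdist y (q i) <= j.+1%:R^-1] else set0).
Proof.
move=> dense oW.
exists (fun i j => `[< [set y | seqdist y (q i) <= j.+1%:R^-1] `<=` W >]).
apply/seteqP; split => [y Wy|y [i _ [j _]]]; last by case: asboolP => // h /h.
have [e e0 He] := open_seqball oW Wy.
have h0 : 0 <= 2 / e by rewrite divr_ge0 // ltW.
pose j := Num.bound (2 / e).
have j1 : 0 < j.+1%:R^-1 :> R by rewrite invr_gt0 ltr0n.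
have je : j.+1%:R^-1 + j.+1%:R^-1 < e.
  have : 2 / e < j.+1%:R by apply: lt_trans (archi_boundP h0) _; rewrite ltr_nat.
  rewrite ltr_pdivrMr // => h; rewrite [X in X < _](_ : _ = 2 / j.+1%:R); last by ring.
  rewrite ltr_pdivrMr ?ltr0n //.
  by rewrite mulrC.
have [i Hi] := dense y _ j1.
exists i => //; exists j => //; case: asboolP => // -[] z /= zi; apply: He.
apply: le_lt_trans je; apply: le_trans (seqdist_tri (q i) _ _) _.
by rewrite lerD // seqdistC.
Qed.

(** The preimage of a ball is again cut out by conditions on the coordinates. *)
Lemma Xshift_measurable : measurable_fun setT (@Xshift R f : borel X -> borel X).
Proof.
have [q dense] := seqdist_dense.
apply: (@measurability _ _ (borel X) (borel X) setT (@Xshift R f) (@open X) erefl).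
move=> _ [W oW <-].
have [S ->] := open_bigcup_seqball dense oW.
rewrite setTI preimage_bigcup; apply: bigcup_measurable => i _.
rewrite preimage_bigcup; apply: bigcup_measurable => j _.
case: (S i j); last by rewrite preimage_set0; exact: measurable0.
rewrite (_ : _ @^-1` _ = [set y | forall n,
    [set y | cmod (coord y (n + 1) - coord (q i) n) <= j.+1%:R^-1] y]).
  by apply: bigcap_coord_measurable => n; exact: coord_ball_measurable.
apply/seteqP; split => y /=.
  by move=> /seqdistP h n; have := h n; rewrite coord_shift.
by move=> h; apply/seqdistP => n; rewrite coord_shift.
Qed.

Variable rho : probability (borel X) R.
Hypothesis invT : invariant_measure rho (@Xshift R f).

Theorem borel_precompact (A : set (borel X)) : measurable A ->
  precompact_set rho (@Xshift R f) A.
Proof.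
have mT := Xshift_measurable.
apply: smallest_sub; first exact: precompact_sigma_algebra.
have [q dense] := seqdist_dense; have [B HB] := seqdist_bounded.
move=> W oW; have [S ->] := open_bigcup_seqball dense oW.
do 2 (apply: precompact_bigcup => // ?).
case: ifP => _; last exact: precompact_set0.
apply: (@precompact_ball _ (borel X) R rho _ mT invT seqdist B q) => //.
- exact: seqdist_lip.
- exact: seqdist_shift.
- exact: closed_seqball_measurable.
Qed.

End SequenceSpace.

Import HBNNSimple.

(** * Density in L2 and conclusion *)
Section SquareIntegrals.
Context d (X : measurableType d) (R : realType) (rho : probability X R).

Definition sqint (f : X -> R) : \bar R := (\int[rho]_x (f x ^+ 2)%:E)%E.

Lemma sqint_ge0 f : (0 <= sqint f)%E.
Proof. by apply: integral_ge0 => x _; rewrite lee_fin sqr_ge0. Qed.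

Lemma measurable_sqr (f : X -> R) : measurable_fun setT f ->
  measurable_fun setT (fun x => (f x ^+ 2)%:E).
Proof. by move=> mf; apply/measurable_EFinP; exact: measurable_funX. Qed.

Lemma sqintB_le (f g h : X -> R) : measurable_fun setT f -> measurable_fun setT g ->
  measurable_fun setT h ->
  (sqint (fun x => f x - h x)%R <=
   2%:E * sqint (fun x => f x - g x)%R + 2%:E * sqint (fun x => g x - h x)%R)%E.
Proof.
move=> mf mg mh.
have mfg := measurable_sqr (measurable_funB mf mg).
have mgh := measurable_sqr (measurable_funB mg mh).
have pos (k : X -> R) x : (setT x -> 0 <= (k x ^+ 2)%:E)%E by rewrite lee_fin sqr_ge0.
rewrite /sqint -!ge0_integralZl //; try by move=> x _; rewrite lee_fin sqr_ge0.
rewrite -ge0_integralD //; last 4 first.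
- by move=> x _; rewrite -EFinM lee_fin mulr_ge0 // sqr_ge0.
- exact: measurable_funeM.
- by move=> x _; rewrite -EFinM lee_fin mulr_ge0 // sqr_ge0.
- exact: measurable_funeM.
apply: ge0_le_integral => //.
- by move=> x _; rewrite lee_fin sqr_ge0.
- exact: measurable_sqr (measurable_funB mf mh).
- by apply: emeasurable_funD; exact: measurable_funeM.
- move=> x _; rewrite -!EFinM -EFinD lee_fin.
  by have := sqr_ge0 (f x - g x - (g x - h x)); lra.
Qed.

Lemma sqint_expect f : bounded_measurable f -> sqint f = (expect rho (fun x => f x ^+ 2))%:E.
Proof. by move=> bf; rewrite EFin_expect //; exact: bmX. Qed.

Lemma cmod_sqr (z : R[i]) : cmod z ^+ 2 = complex.Re z ^+ 2 + complex.Im z ^+ 2.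
Proof. by case: z => a b; rewrite /cmod /= sqr_sqrtr // addr_ge0 // sqr_ge0. Qed.

Definition complex_sqint (g : X -> R[i]) : \bar R :=
  (sqint (fun x => complex.Re (g x)) + sqint (fun x => complex.Im (g x)))%E.

Lemma complex_sqint_ge0 g : (0 <= complex_sqint g)%E.
Proof. by rewrite adde_ge0 // sqint_ge0. Qed.

Lemma L2normE (g : X -> R[i]) : measurable_fun setT (fun x => complex.Re (g x)) ->
  measurable_fun setT (fun x => complex.Im (g x)) ->
  L2norm rho g = (complex_sqint g `^ 2^-1)%E.
Proof.
move=> mr mi; rewrite /L2norm unlock /complex_sqint /sqint.
rewrite -ge0_integralD //; last 4 first.
- by move=> x _; rewrite lee_fin sqr_ge0.
- exact: measurable_sqr.
- by move=> x _; rewrite lee_fin sqr_ge0.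
- exact: measurable_sqr.
congr (_ `^ _)%E; apply: eq_integral => x _.
by rewrite -EFinD -cmod_sqr /= ger0_norm ?cmod_ge0 // powR_mulrn // cmod_ge0.
Qed.

Lemma lt_poweR_half (x : \bar R) (e : R) : (0 <= x)%E -> 0 < e ->
  (x < (e ^+ 2)%:E)%E -> (x `^ 2^-1 < e%:E)%E.
Proof.
case: x => [x| |] //= x0 e0; rewrite !lte_fin => xe.
rewrite powR12_sqrt //; rewrite -(ltr_pXn2r (ltn0Sn 1)) ?nnegrE ?sqrtr_ge0 ?(ltW e0) //.
by rewrite sqr_sqrtr.
Qed.

(** Simple functions s increasing to f satisfy (f - s)^2 <= f^2, so that dominated
convergence applies. *)
Lemma nnsfun_dense_L2 (f : X -> R) (e : R) : measurable_fun setT f ->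
  (forall x, 0 <= f x) -> (sqint f < +oo)%E -> 0 < e ->
  exists s : {nnsfun X >-> R}, (sqint (fun x => f x - s x)%R < e%:E)%E.
Proof.
move=> mf f0 If e0.
have mEf : measurable_fun setT (EFin \o f) by exact/measurable_EFinP.
have [s [nds cvs]] := approximation measurableT mEf (fun x _ => f0 x).
have sf n x : 0 <= s n x <= f x.
  have /fine_cvgP[_ cvx] := cvs x I.
  have hl : limn (fun n => s n x) = f x by apply/cvg_lim.
  apply/andP; split => //; rewrite -hl.
  apply: (@nondecreasing_cvgn_le _ (fun n => s n x)); last by apply/cvg_ex; exists (f x).
  by move=> a b ab; exact/lefP/nds.
have ms n : measurable_fun setT (s n) by exact: measurable_funP.
have ig : rho.-integrable setT (fun x => (f x ^+ 2)%:E).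
  apply/integrableP; split; first exact: measurable_sqr.
  by under eq_integral do rewrite gee0_abs ?lee_fin ?sqr_ge0 //.
have := @dominated_convergence _ X R rho setT measurableT
  (fun n x => ((f x - s n x) ^+ 2)%:E) (fun=> 0%E) (fun x => (f x ^+ 2)%:E).
case => //.
- by move=> n; exact: measurable_sqr (measurable_funB mf (ms n)).
- apply: aeW => x _.
  have /fine_cvgP[_ cvx] := cvs x I.
  have : (fun n => (f x - s n x) * (f x - s n x)) @ \oo --> (f x - f x) * (f x - f x).
    by apply: cvgM; apply: cvgB => //; exact: cvg_cst.
  by rewrite subrr mulr0 => H; apply: cvg_EFin; [exact: nearW | exact: H].
- apply: aeW => x n _; rewrite gee0_abs ?lee_fin ?sqr_ge0 //.
  by have /andP[h1 h2] := sf n x; rewrite ler_pXn2r ?nnegrE // ?subr_ge0 // lerBlDr lerDl.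
move=> _ _; rewrite integral0 => /fine_cvgP[fin /cvgrPdist_lt/(_ _ e0) cv].
near \oo => n; exists (s n).
have fn : (\int[rho]_x ((f x - s n x) ^+ 2)%:E)%E \is a fin_num by near: n; exact: fin.
rewrite /sqint -(fineK fn) lte_fin.
have : `|0 - fine (\int[rho]_x ((f x - s n x) ^+ 2)%:E)%E| < e by near: n; exact: cv.
by rewrite sub0r normrN; apply: le_lt_trans; exact: ler_norm.
Unshelve. all: by end_near.
Qed.

End SquareIntegrals.

Import HBSimple HBNNSimple.

Section DiscreteSpectrum.
Context d (X : measurableType d) (R : realType) (rho : probability X R).
Variable T : X -> X.
Hypothesis mT : measurable_fun setT T.
Hypothesis invT : invariant_measure rho T.
Hypothesis all_precompact : forall A, measurable A -> precompact_set rho T A.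
Local Notation V := (bfun X R).
Local Notation nrm := (nrm (bdot rho)).
Local Notation U := (koopman mT).
Local Notation tb := (precompact_orbit (bdot rho) U).
Local Notation complex_sqint := (complex_sqint rho).

Lemma nnsfun_bfun (s : {nnsfun X >-> R}) :
  exists2 v : V, tb v & forall x, v x = (s x)%:C%C :> R[i].
Proof.
have mA i : measurable (s @^-1` [set (fset_set (range s))`_i]) by exact: measurable_sfunP.
exists (\sum_(i < #|` fset_set (range s)|)
  ((fset_set (range s))`_i)%:C%C *: (bindic R (mA i) : V)).
  apply: precompact_orbit_sum => // i; apply: precompact_orbitZ => //.
  by apply: precompact_bindic => //; exact: all_precompact.
move=> x; rewrite bfun_sum fimfunEord rmorph_sum; apply: eq_bigr => i _.
by rewrite bfunZ rmorphM.
Qed.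

Lemma real_bfun_dense (f : X -> R) (e : R) : measurable_fun setT f ->
  (sqint rho f < +oo)%E -> 0 < e ->
  exists2 v : V, tb v & (sqint rho (fun x => f x - complex.Re (v x))%R < e%:E)%E /\
    forall x, complex.Im (v x) = 0.
Proof.
move=> mf If e0; have e4 : 0 < e / 4 by lra.
pose fp x := Num.max (f x) 0; pose fn x := Num.max (- f x) 0.
have mfp : measurable_fun setT fp by apply: measurable_maxr => //; exact: measurable_cst.
have mfn : measurable_fun setT fn.
  by apply: measurable_maxr; [exact: measurable_funN | exact: measurable_cst].
have dom (g : X -> R) : measurable_fun setT g -> (forall x, g x ^+ 2 <= f x ^+ 2) ->
    (sqint rho g < +oo)%E.
  move=> mg gf; apply: le_lt_trans If; apply: ge0_le_integral => //.
  - by move=> x _; rewrite lee_fin sqr_ge0.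
  - exact: measurable_sqr.
  - exact: measurable_sqr.
  - by move=> x _; rewrite lee_fin.
have Ip : (sqint rho fp < +oo)%E.
  by apply: dom => // x; rewrite /fp; case: (ltP (f x) 0) => // _; rewrite expr0n sqr_ge0.
have In : (sqint rho fn < +oo)%E.
  by apply: dom => // x; rewrite /fn; case: (ltP (- f x) 0) => // _; rewrite ?sqrrN // expr0n sqr_ge0.
have fp0 x : 0 <= fp x by rewrite /fp le_max lexx orbT.
have fn0 x : 0 <= fn x by rewrite /fn le_max lexx orbT.
have [s1 Hs1] := nnsfun_dense_L2 mfp fp0 Ip e4.
have [s2 Hs2] := nnsfun_dense_L2 mfn fn0 In e4.
have [v1 tb1 E1] := nnsfun_bfun s1; have [v2 tb2 E2] := nnsfun_bfun s2.
have tbN : tb (- v2) by have := precompact_orbitZ invT (-1) tb2; rewrite scaleN1r.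
exists (v1 - v2); first exact: (precompact_orbitD invT tb1 tbN).
split; last by move=> x; rewrite bfunB ImB E1 E2 /= subrr.
have ms (s : {nnsfun X >-> R}) : measurable_fun setT s by exact: measurable_funP.
have fE x : f x = fp x - fn x.
  by rewrite /fp /fn; have [h|h] := ltP (f x) 0; have [h'|h'] := ltP (- f x) 0; lra.
have m1 : measurable_fun setT (fun x => fp x - s1 x) by exact: measurable_funB.
have m2 : measurable_fun setT (fun x => fn x - s2 x) by exact: measurable_funB.
have m0 : measurable_fun setT (fun x : X => 0 : R) by exact: measurable_cst.
have := sqintB_le rho m1 m0 m2.
rewrite (_ : (fun x => fp x - s1 x - 0) = (fun x => fp x - s1 x)); last first.
  by apply/funext => x; rewrite subr0.
rewrite (_ : sqint rho (fun x => 0 - (fn x - s2 x)) = sqint rho (fun x => fn x - s2 x)); last first.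
  by apply: eq_integral => x _; rewrite sub0r sqrrN.
rewrite (_ : (fun x => fp x - s1 x - (fn x - s2 x)) = (fun x => f x - complex.Re ((v1 - v2) x))); last first.
  by apply/funext => x; rewrite bfunB ReB E1 E2 fE /=; ring.
move=> h; apply: le_lt_trans h _.
rewrite (_ : e%:E = 2%:E * (e / 4)%:E + 2%:E * (e / 4)%:E)%E; last first.
  by rewrite -EFinM -EFinD; congr EFin; field.
have fin (x : \bar R) : (0 <= x)%E -> (x < (e / 4)%:E)%E -> (2%:E * x < 2%:E * (e / 4)%:E)%E.
  by move=> x0 xe; rewrite lte_pmul2l // lte_fin.
apply: lteD; apply: fin => //; exact: sqint_ge0.
Qed.

Lemma complex_sqint_bfun (v : V) : complex_sqint v = (nrm v ^+ 2)%:E.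
Proof.
rewrite /complex_sqint !sqint_expect; [|exact: bfun_Im|exact: bfun_Re].
by rewrite (nrm_sqr (bdotP rho)) bdotE EFinD.
Qed.

Lemma L2_bfun (v : V) : L2 rho v.
Proof.
split; [by case: (bfun_Re v) | by case: (bfun_Im v) |].
rewrite L2normE; [|by case: (bfun_Re v)|by case: (bfun_Im v)].
by rewrite complex_sqint_bfun poweR_lty // ltry.
Qed.

Lemma L2_sqint (h : X -> R[i]) : L2 rho h ->
  (sqint rho (fun x => complex.Re (h x)) < +oo)%E /\ (sqint rho (fun x => complex.Im (h x)) < +oo)%E.
Proof.
move=> [mr mi]; rewrite L2normE // => /lty_poweRy; rewrite invr_neq0 // => /(_ isT).
rewrite /complex_sqint => H; split; apply: le_lt_trans H.
  by rewrite leeDl // sqint_ge0.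
by rewrite leeDr // sqint_ge0.
Qed.

Lemma bfun_dense (h : X -> R[i]) (e : R) : L2 rho h -> 0 < e ->
  exists2 v : V, tb v & (complex_sqint (fun x => h x - v x)%R < e%:E)%E.
Proof.
move=> L2h e0; have [Ir Ii] := L2_sqint L2h; have [mr mi _] := L2h.
have e2 : 0 < e / 2 by lra.
have [v1 t1 [H1 I1]] := real_bfun_dense mr Ir e2.
have [v2 t2 [H2 I2]] := real_bfun_dense mi Ii e2.
exists (v1 + 'i%C *: v2).
  exact: (precompact_orbitD invT t1 (precompact_orbitZ invT 'i%C t2)).
rewrite /complex_sqint [X in (_ < X%:E)%E]splitr EFinD; apply: lteD.
- rewrite (_ : (fun x => _) = (fun x => complex.Re (h x) - complex.Re (v1 x))) //.
  by apply/funext => x; rewrite ReB bfunD ReD bfunZ ReM /= I2; ring.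
- rewrite (_ : (fun x => _) = (fun x => complex.Im (h x) - complex.Re (v2 x))) //.
  by apply/funext => x; rewrite ImB bfunD ImD bfunZ ImM /= I1; ring.
Qed.

Lemma nrm0_ae (v : V) : nrm v = 0 <-> ((v : X -> R[i]) = (fun=> 0) %[ae rho]).
Proof.
have mv : measurable_fun setT (fun x => (complex.Re (v x) ^+ 2 + complex.Im (v x) ^+ 2)%:E).
  by apply/measurable_EFinP; case: (bmD (bmX (bfun_Re v)) (bmX (bfun_Im v))).
have abs x : (`|(complex.Re (v x) ^+ 2 + complex.Im (v x) ^+ 2)%:E| =
    (complex.Re (v x) ^+ 2 + complex.Im (v x) ^+ 2)%:E)%E.
  by rewrite gee0_abs // lee_fin addr_ge0 // sqr_ge0.
have E : (\int[rho]_x `|(complex.Re (v x) ^+ 2 + complex.Im (v x) ^+ 2)%:E| = (nrm v ^+ 2)%:E)%E.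
  under eq_integral do rewrite abs.
  rewrite (nrm_sqr (bdotP rho)) /bdot EFin_expect; last exact: bdot_bm.
  by apply: eq_integral => x _; rewrite !expr2.
have K := ae_eq_integral_abs rho measurableT mv.
split => [v0|h].
- have : (nrm v ^+ 2)%:E = 0%E :> \bar R by rewrite v0 expr0n.
  rewrite -E => /K; apply: filterS => x hx _; 
  have h : complex.Re (v x) ^+ 2 + complex.Im (v x) ^+ 2 = 0 by apply: EFin_inj; exact: hx I.
  apply/eqP; rewrite eq_complex /=.
  have r0 := sqr_ge0 (complex.Re (v x)); have i0 := sqr_ge0 (complex.Im (v x)).
  apply/andP; split; rewrite -sqrf_eq0; apply/eqP; lra.
- have : (nrm v ^+ 2)%:E = 0%E :> \bar R.
    rewrite -E; apply/K; apply: filterS h => x hx _ /=.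
    by rewrite (hx I) /= expr0n addr0.
  by move=> h0; apply/eqP; rewrite -sqrf_eq0; apply/eqP; apply: EFin_inj.
Qed.

Lemma unimodular_conjM (z : R[i]) : unimodular z -> (z^*)%C * z = 1.
Proof.
case: z => a b; rewrite /unimodular /= => ab; apply/eqP; rewrite eq_complex /=.
by rewrite mulNr opprK -!expr2 ab mulNr [b * a]mulrC subrr !eqxx.
Qed.

(** Since e is fixed by z U, its eigenvalue is the conjugate of z. *)
Lemma eigenfunction_bfun (z : R[i]) (e : V) : unimodular z ->
  nrm (rot U z e - e) = 0 -> 0 < nrm e -> eigenfunction rho T e.
Proof.
move=> z1 /nrm0_ae fix_e e0; split; first exact: L2_bfun.
  by move=> /nrm0_ae h; rewrite h ltxx in e0.
exists (z^*)%C; apply: filterS fix_e => x hx _; have /eqP := hx I.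
rewrite bfunB /rot bfunZ koopmanE subr_eq0 => /eqP <-.
by rewrite mulrA unimodular_conjM // mul1r.
Qed.

(** Approximate an L2 function by a simple one, whose orbit is precompact, and the
latter by a sum of eigenvectors. *)
Theorem precompact_discrete_spectrum : discrete_spectrum rho T.
Proof.
have : forall p : R[i] * V, exists e, unimodular p.1 ->
    mean_limit (bdot rho) (rot U p.1) p.2 e.
  move=> [z v] /=; have [z1|no] := pselect (unimodular z); last by exists v => /no.
  by have [e He] := bfun_mean_limit mT invT v z1; exists e.
move=> /choice[E0 HE0]; pose E z v := E0 (z, v).
have limE z v : unimodular z -> mean_limit (bdot rho) (rot U z) v (E z v).
  exact: (HE0 (z, v)).
apply/seteqP; split => [h []//|h L2h]; split => // e e0.
have e4 : 0 < e ^+ 2 / 4 / 2 by rewrite !divr_gt0 // exprn_gt0.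
have [v tbv Hv] := bfun_dense L2h e4.
have e3 : 0 < e / 4 by lra.
have iso := koopman_isometry mT invT.
have [s [us sH Hs]] := precompact_orbit_span (bdotP rho) iso limE tbv e3.
pose k : V := \sum_(z <- s) E z v.
exists k.
  exists (size s), (fun=> 1), (fun i : 'I_(size s) => bval (E s`_i v)); split.
    move=> i; have [z1 zpos] := sH s`_i (mem_nth 0 (ltn_ord i)).
    by apply: (eigenfunction_bfun z1 _ zpos); exact: (fixedE (bdotP rho) iso limE).
  apply/funext => x; rewrite /k bfun_sum (big_nth 0) big_mkord.
  by apply: eq_bigr => i _; rewrite mul1r.
have [mr mi _] := L2h.
have [mkr _] := bfun_Re k; have [mki _] := bfun_Im k.
have [mvr _] := bfun_Re v; have [mvi _] := bfun_Im v.
have mrk : measurable_fun setT (fun x => complex.Re (h x - k x)).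
  rewrite (_ : (fun x => _) = (fun x => complex.Re (h x) - complex.Re (k x))).
    exact: measurable_funB.
  by apply/funext => x; rewrite ReB.
have mik : measurable_fun setT (fun x => complex.Im (h x - k x)).
  rewrite (_ : (fun x => _) = (fun x => complex.Im (h x) - complex.Im (k x))).
    exact: measurable_funB.
  by apply/funext => x; rewrite ImB.
rewrite L2normE //; apply: lt_poweR_half => //; first exact: complex_sqint_ge0.
have tri : (complex_sqint (fun x => h x - k x)%R <=
    2%:E * complex_sqint (fun x => h x - v x)%R + 2%:E * complex_sqint (v - k)%R)%E.
  have := sqintB_le rho mr mvr mkr; have := sqintB_le rho mi mvi mki => hi hr.
  rewrite /complex_sqint.
  have R1 (a b : X -> R[i]) : (fun x => complex.Re (a x - b x)) =
    (fun x => complex.Re (a x) - complex.Re (b x)) by apply/funext => x; rewrite ReB.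
  have I1 (a b : X -> R[i]) : (fun x => complex.Im (a x - b x)) =
    (fun x => complex.Im (a x) - complex.Im (b x)) by apply/funext => x; rewrite ImB.
  have aux (p q r t : \bar R) : (0 <= p -> 0 <= q -> 0 <= r -> 0 <= t ->
      2%:E * p + 2%:E * q + (2%:E * r + 2%:E * t) = 2%:E * (p + r) + 2%:E * (q + t))%E.
    by move=> p0 q0 r0 t0; rewrite !ge0_muleDr // addeACA.
  rewrite !R1 !I1; apply: le_trans (leeD hr hi) _.
  by rewrite aux ?sqint_ge0.
apply: le_lt_trans tri _.
rewrite complex_sqint_bfun.
have n1 : nrm (v - k) ^+ 2 < (e / 4) ^+ 2 by rewrite ltr_pXn2r ?nnegrE ?nrm_ge0 // ltW.
have h1 : (2%:E * complex_sqint (fun x => h x - v x)%R < (e ^+ 2 / 4)%:E)%E.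
  rewrite (_ : (e ^+ 2 / 4)%:E = 2%:E * (e ^+ 2 / 4 / 2)%:E)%E.
    by rewrite lte_pmul2l // lte_fin.
  by rewrite -EFinM; congr EFin; field.
have h2 : (2%:E * (nrm (v - k)%R ^+ 2)%:E < (e ^+ 2 / 4)%:E)%E.
  by rewrite -EFinM lte_fin; have := exprn_gt0 2 e0; lra.
apply: lt_trans (lteD h1 h2) _.
by rewrite -EFinD lte_fin; have := exprn_gt0 2 e0; lra.
Qed.

End DiscreteSpectrum.

Theorem proposition6p1 (R : realType) (f : int -> R[i]%C)
  (rho : probability (borel (Xspace f)) R) :
  KZ f -> invariant_measure rho (@Xshift R f) ->
  discrete_spectrum rho (@Xshift R f).
Proof.
move=> hf invT; apply: (precompact_discrete_spectrum (Xshift_measurable hf)) => //.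
exact: borel_precompact.
Qed.
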